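(* Let $d\ge 2$, and let $\alpha\in\mathbb{R}$ satisfy either $\alpha=d-1$, or $\alpha\in\mathbb{R}\setminus\mathbb{Z}$ and $\alpha<d$. Let $f\in\mathscr{O}_C'(\mathbb{R}^d)$ and let $V\subset\mathbb{R}^d$ be any nonempty open set. If $f|_V=I_\alpha f|_V=0$, then $f=0$.
   Context: $\mathscr{S}'(\mathbb{R}^d)$ is the space of tempered distributions. $\mathscr{O}_M(\mathbb{R}^d)$ is the space of polynomially increasing smooth functions (smooth functions all of whose derivatives are polynomially bounded). $\mathscr{O}_C'(\mathbb{R}^d)\subset\mathscr{S}'(\mathbb{R}^d)$ is the space of rapidly decreasing distributions: those $f$ such that for every $k\in\mathbb{N}$ one can write $f$ as a finite sum $\sum_\beta\partial^\beta g_\beta$ with $g_\beta$ continuous and $(1+|x|^2)^{k/2}g_\beta$ bounded; equivalently, those tempered distributions whose Fourier transform lies in $\mathscr{O}_M(\mathbb{R}^d)$. Convolution is a separately continuous map $*:\mathscr{O}_C'(\mathbb{R}^d)\times\mathscr{S}'(\mathbb{R}^d)\to\mathscr{S}'(\mathbb{R}^d)$, characterized (up to Fourier normalization constants) by $\widehat{f*g}=\widehat f\cdot\widehat g$. For $\alpha<d$ the function $|x|^{-\alpha}$ is locally integrable and defines a tempered distribution, and the Riesz potential of $f\in\mathscr{O}_C'(\mathbb{R}^d)$ is $I_\alpha f=f*|\cdot|^{-\alpha}\in\mathscr{S}'(\mathbb{R}^d)$. *)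

(* Defs.v *)
From HB Require Import structures.
From mathcomp Require Import all_boot all_order all_algebra.
From mathcomp Require Import all_classical all_reals all_analysis.
From mathcomp Require Import complex ring lra.

Set Implicit Arguments.
Unset Strict Implicit.
Unset Printing Implicit Defensive.

Import Order.TTheory GRing.Theory Num.Theory.
Import numFieldNormedType.Exports.
Import ComplexField.

Local Open Scope classical_set_scope.
Local Open Scope complex_scope.
Local Open Scope ring_scope.

Definition consT (R : realType) n (p : R * n.-tuple R) : n.+1.-tuple R :=
  [tuple of p.1 :: p.2].

Lemma thead_consT (R : realType) n (p : R * n.-tuple R) : thead (consT p) = p.1.
Proof. exact: theadE. Qed.

Lemma behead_consT (R : realType) n (p : R * n.-tuple R) :
  [tuple of behead (consT p)] = p.2.
Proof. exact: val_inj. Qed.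

Lemma measurable_consT (R : realType) n : measurable_fun setT (@consT R n).
Proof.
by apply: measurable_cons; [exact: measurable_fst|exact: measurable_snd].
Qed.

Section LebesgueCons.
Context (R : realType) n (m : {sigma_finite_measure set (n.-tuple R) -> \bar R}).

Definition lebesgue_cons : set (n.+1.-tuple R) -> \bar R :=
  pushforward (lebesgue_measure \x m)%E (@consT R n).

Let mu : {measure set (n.+1.-tuple R) -> \bar R} :=
  measure_function_pushforward__canonical__measure_function_Measure
  (lebesgue_measure \x m)%E (@measurable_consT R n).
HB.instance Definition _ := Measure.copy lebesgue_cons mu.

Lemma lebesgue_consE (A : set R) (B : set (n.-tuple R)) :
  measurable A -> measurable B ->
  lebesgue_cons [set t | A (thead t) /\ B [tuple of behead t]] =
    (lebesgue_measure A * m B)%E.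
Proof.
move=> mA mB; rewrite -product_measure1E//; congr (product_measure1 _ _ _).
by apply/seteqP; split=> p /=; rewrite thead_consT behead_consT.
Qed.

Lemma lebesgue_cons_sigma_finite : sigma_finite setT lebesgue_cons.
Proof.
have /sigma_finiteP[F [TF ndF Foo]] := sigma_finiteT (@lebesgue_measure R).
have /sigma_finiteP[G [TG ndG Goo]] := sigma_finiteT m.
exists (fun k => [set t | F k (thead t) /\ G k [tuple of behead t]]).
  apply/esym; rewrite -subTset => t _.
  have [i _ Fi] : (\bigcup_i F i) (thead t) by rewrite -TF.
  have [j _ Gj] : (\bigcup_i G i) [tuple of behead t] by rewrite -TG.
  exists (maxn i j) => //; split.
    by move: Fi; apply/subsetPset/ndF/leq_maxl.
  by move: Gj; apply/subsetPset/ndG/leq_maxr.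
move=> k; have [mF Fk] := Foo k; have [mG Gk] := Goo k; split; last first.
  by rewrite lebesgue_consE// lte_mul_pinfty// ge0_fin_numE.
apply: measurableI.
  rewrite -[X in measurable X]setTI.
  exact: (measurable_tnth (ord0 : 'I_n.+1) measurableT mF).
rewrite -[X in measurable X]setTI.
exact: (@measurable_behead _ R n measurableT _ mG).
Qed.
HB.instance Definition _ :=
  Measure_isSigmaFinite.Build _ _ _ lebesgue_cons lebesgue_cons_sigma_finite.
End LebesgueCons.

Fixpoint lebesgue_tuple (R : realType) n :
    {sigma_finite_measure set (n.-tuple R) -> \bar R} :=
  if n is n'.+1 then lebesgue_cons (lebesgue_tuple R n') else \d_[tuple].

Lemma lebesgue_tuple_box (R : realType) n (A : 'I_n -> set R) :
  (forall i, measurable (A i)) ->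
  lebesgue_tuple R n [set t | forall i, A i (tnth t i)] =
    (\prod_(i < n) lebesgue_measure (A i))%E.
Proof.
elim: n A => [|n IH] A mA.
  by rewrite big_ord0 /= diracE mem_set//= => -[].
have mB : measurable [set t : n.-tuple R | forall i, A (lift ord0 i) (tnth t i)].
  rewrite (_ : mkset _ = \bigcap_(i in [set: 'I_n])
      [set t | A (lift ord0 i) (tnth t i)]); last first.
    by apply/seteqP; split=> t At i => [_|]; exact: At.
  apply: fin_bigcap_measurable => // i _; rewrite -[X in measurable X]setTI.
  exact: measurable_tnth.
rewrite big_ord_recl -(IH (fun i => A (lift ord0 i))) //= -lebesgue_consE//.
congr (lebesgue_cons _ _); apply/seteqP; split=> t /=.
  move=> At; split; first exact: At.
  by move=> i; rewrite tnth_behead (_ : inord _ = lift ord0 i)//; apply/val_inj;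
    rewrite /= inordK// ltnS.
case=> A0 At i; have [->|i0] := eqVneq i ord0; first exact: A0.
have [j ij] : exists j, i = lift ord0 j.
  by case: (unliftP ord0 i) i0 => [j -> _|-> /eqP//]; exists j.
have := At j; rewrite tnth_behead ij.
by rewrite (_ : inord _ = lift ord0 j)//; apply/val_inj; rewrite /= inordK// ltnS.
Qed.

(* The library norm of ['rV[R]_d] is the maximum norm. *)
Definition enorm (R : realType) d (x : 'rV[R]_d) : R :=
  Num.sqrt (\sum_i x 0 i ^+ 2).

Definition jbracket (R : realType) d (x : 'rV[R]_d) : R :=
  Num.sqrt (1 + enorm x ^+ 2).

Section Schwartz.
Context {R : realType} {d : nat}.
Local Notation E := 'rV[R]_d.
Local Notation C := R[i].
Local Notation Re := complex.Re.
Local Notation Im := complex.Im.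
Local Notation normc := Normc.normc.
Implicit Types (phi psi : E -> C^o) (x y : E) (s : seq 'I_d).

(* [R[i]] carries no real normed structure in the library, so that
   differentiability, continuity and integrals of complex-valued functions
   are taken on real and imaginary parts. *)
Definition cdifferentiable phi :=
  forall x, differentiable (fun y => Re (phi y)) x /\
            differentiable (fun y => Im (phi y)) x.

Definition ccontinuous phi :=
  continuous (fun y => Re (phi y)) /\ continuous (fun y => Im (phi y)).

Definition pderive (i : 'I_d) phi : E -> C^o := fun x =>
  ('D_(delta_mx 0 i) (fun y => Re (phi y)) x +i*
   'D_(delta_mx 0 i) (fun y => Im (phi y)) x)%C.

(* A multi-index is a list of directions, its order being the length of the
   list; on smooth functions the order of the directions is immaterial. *)
Definition pderives s phi : E -> C^o := foldr pderive phi s.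

Definition smooth phi := forall s, cdifferentiable (pderives s phi).

Definition weighted (k : nat) s phi : set R :=
  range (fun x => jbracket x ^+ k * normc (pderives s phi x)).

Definition schwartz_fun : {pred E -> C^o} := fun phi =>
  `[< smooth phi /\ forall k s, has_ubound (weighted k s phi) >].

Lemma schwartz_funP phi : reflect
  (smooth phi /\ forall k s, has_ubound (weighted k s phi))
  (phi \in schwartz_fun).
Proof. exact: asboolP. Qed.

Lemma Re_lin (a : C) phi psi :
  (fun y => Re ((a *: phi + psi) y)) =
  Re a *: (fun y => Re (phi y)) + (- Im a) *: (fun y => Im (phi y))
    + (fun y => Re (psi y)).
Proof.
apply/funext => y; rewrite !fctE.
by case: a (phi y) (psi y) => [? ?] [? ?] [? ?] /=; rewrite scaleNr.
Qed.

Lemma Im_lin (a : C) phi psi :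
  (fun y => Im ((a *: phi + psi) y)) =
  Re a *: (fun y => Im (phi y)) + Im a *: (fun y => Re (phi y))
    + (fun y => Im (psi y)).
Proof.
apply/funext => y; rewrite !fctE.
by case: a (phi y) (psi y) => [? ?] [? ?] [? ?].
Qed.

Lemma differentiable_lin3 (a b : R) (f g h : E -> R) x :
  differentiable f x -> differentiable g x -> differentiable h x ->
  differentiable (a *: f + b *: g + h) x.
Proof.
move=> df dg dh.
have df' := differentiableZ a df; have dg' := differentiableZ b dg.
exact: (differentiableD (differentiableD df' dg') dh).
Qed.

Lemma derive_lin3 (a b : R) (f g h : E -> R) x v :
  differentiable f x -> differentiable g x -> differentiable h x ->
  'D_v (a *: f + b *: g + h) x = a * 'D_v f x + b * 'D_v g x + 'D_v h x.
Proof.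
move=> df dg dh.
have df1 := @diff_derivable _ _ _ _ _ v df; have dg1 := @diff_derivable _ _ _ _ _ v dg.
have dh1 := @diff_derivable _ _ _ _ _ v dh.
have df' : derivable (a *: f) x v by exact: derivableZ.
have dg' : derivable (b *: g) x v by exact: derivableZ.
by rewrite (deriveD (derivableD df' dg') dh1) (deriveD df' dg') !deriveZ.
Qed.

Lemma cdifferentiable_lin (a : C) phi psi :
  cdifferentiable phi -> cdifferentiable psi ->
  cdifferentiable (a *: phi + psi).
Proof.
move=> dphi dpsi x; have [dr di] := dphi x; have [er ei] := dpsi x.
by split; [rewrite Re_lin|rewrite Im_lin]; exact: differentiable_lin3.
Qed.

Lemma pderive_lin i (a : C) phi psi :
  cdifferentiable phi -> cdifferentiable psi ->
  pderive i (a *: phi + psi) = a *: pderive i phi + pderive i psi.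
Proof.
move=> dphi dpsi; apply/funext => x.
have [dr di] := dphi x; have [er ei] := dpsi x.
rewrite /pderive Re_lin Im_lin !derive_lin3// !fctE.
by case: a => ar ai; apply/eqP; rewrite eq_complex /= mulNr !eqxx.
Qed.

Lemma pderives_lin s (a : C) phi psi : smooth phi -> smooth psi ->
  pderives s (a *: phi + psi) = a *: pderives s phi + pderives s psi.
Proof.
by move=> sphi spsi; elim: s => //= i s ->; rewrite pderive_lin.
Qed.

Lemma pderive0 i : pderive i 0 = 0.
Proof.
apply/funext => x; rewrite /pderive.
by apply/eqP; rewrite eq_complex; apply/andP; split; apply/eqP; exact: derive_cst.
Qed.

Lemma pderives0 s : pderives s 0 = 0.
Proof. by elim: s => //= i s ->; rewrite pderive0. Qed.

Lemma jbracket_ge0 x : 0 <= jbracket x.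
Proof. exact: sqrtr_ge0. Qed.

Lemma normc_ge0 (z : C) : 0 <= normc z.
Proof. by case: z => a b; exact: sqrtr_ge0. Qed.

Lemma schwartz_fun_submod : submod_closed schwartz_fun.
Proof.
split=> [|a phi psi /schwartz_funP[sphi bphi] /schwartz_funP[spsi bpsi]].
  apply/schwartz_funP; split=> [s x|k s].
    rewrite pderives0.
    by split; exact: differentiable_cst.
  by exists 0 => _ [x _ <-]; rewrite pderives0 Normc.normc0 mulr0.
apply/schwartz_funP; split=> [s|k s].
  by rewrite pderives_lin//; exact: cdifferentiable_lin.
have [M ubM] := bphi k s; have [N ubN] := bpsi k s.
exists (normc a * M + N) => _ [x _ <-]; rewrite pderives_lin// !fctE.
apply: (@le_trans _ _ (jbracket x ^+ k *
    (normc a * normc (pderives s phi x) + normc (pderives s psi x)))).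
  rewrite ler_wpM2l ?exprn_ge0 ?jbracket_ge0//.
  by rewrite -Normc.normcM; exact: le_normcD.
rewrite mulrDr mulrCA lerD//; last by apply: ubN; exists x.
by rewrite ler_wpM2l ?normc_ge0//; apply: ubM; exists x.
Qed.

HB.instance Definition _ :=
  GRing.isSubmodClosed.Build _ _ schwartz_fun schwartz_fun_submod.

Lemma pderives_rcons s i phi : pderives (rcons s i) phi = pderives s (pderive i phi).
Proof. exact: foldr_rcons. Qed.

Lemma schwartz_fun_pderive i phi :
  phi \in schwartz_fun -> pderive i phi \in schwartz_fun.
Proof.
case/schwartz_funP=> sphi bphi; apply/schwartz_funP; split=> [s|k s].
  by rewrite -pderives_rcons; exact: sphi.
by have := bphi k (rcons s i); rewrite /weighted pderives_rcons.
Qed.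

Definition translate_fun x phi : E -> C^o := fun y => phi (x + y).

Lemma pderives_translate x s phi :
  pderives s (translate_fun x phi) = translate_fun x (pderives s phi).
Proof.
elim: s => //= i s ->; apply/funext => y; rewrite /translate_fun /pderive.
have D (f : E -> R) v : 'D_v (fun z => f (x + z)) y = 'D_v f (x + y).
  by rewrite /derive; under eq_fun do rewrite /= addrCA.
by apply/eqP; rewrite eq_complex; apply/andP; split; apply/eqP; exact: D.
Qed.

Lemma jbracket_translate x y :
  jbracket y <= Num.sqrt 2 * jbracket x * jbracket (x + y).
Proof.
have e2 (z : E) : enorm z ^+ 2 = \sum_i z 0 i ^+ 2.
  by rewrite sqr_sqrtr// sumr_ge0// => i _; exact: sqr_ge0.
have e0 (z : E) : 0 <= enorm z ^+ 2 by exact: sqr_ge0.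
have e1 (z : E) : 0 <= 1 + enorm z ^+ 2 by apply: addr_ge0; [exact: ler01|exact: e0].
have e3 : 0 <= 2 * (1 + enorm x ^+ 2) by exact: mulr_ge0 (ler0n R 2) (e1 x).
rewrite /jbracket -(sqrtrM _ (ler0n R 2)) -(sqrtrM _ e3); apply: ler_wsqrtr.
have : enorm y ^+ 2 <= 2 * enorm x ^+ 2 + 2 * enorm (x + y) ^+ 2.
  rewrite !e2 !mulr_sumr -big_split/= ler_sum// => i _; rewrite mxE.
  by have := sqr_ge0 (2 * x 0 i + y 0 i); nra.
have := mulr_ge0 (e0 x) (e0 (x + y)).
move: (enorm x ^+ 2) (enorm (x + y) ^+ 2) (enorm y ^+ 2) => a b c; nra.
Qed.

Lemma schwartz_fun_translate x phi :
  phi \in schwartz_fun -> translate_fun x phi \in schwartz_fun.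
Proof.
case/schwartz_funP=> sphi bphi; apply/schwartz_funP; split=> [s y|k s].
  have [dr di] := sphi s (x + y); rewrite pderives_translate /translate_fun.
  have dx : differentiable (fun z : E => x + z) y.
    by apply: differentiableD => //; exact: differentiable_cst.
  by split; [exact: (differentiable_comp dx dr)|exact: (differentiable_comp dx di)].
have [M ubM] := bphi k s; exists ((Num.sqrt 2 * jbracket x) ^+ k * M).
move=> _ [y _ <-]; rewrite pderives_translate /translate_fun.
apply: (@le_trans _ _ ((Num.sqrt 2 * jbracket x * jbracket (x + y)) ^+ k *
    normc (pderives s phi (x + y)))).
  rewrite ler_wpM2r ?normc_ge0// lerXn2r ?nnegrE ?jbracket_ge0//.
    by rewrite !mulr_ge0 ?sqrtr_ge0 ?jbracket_ge0.
  exact: jbracket_translate.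
rewrite exprMn -mulrA ler_wpM2l ?exprn_ge0 ?mulr_ge0 ?sqrtr_ge0 ?jbracket_ge0//.
by apply: ubM; exists (x + y).
Qed.

Definition schwartz : Type := {phi : E -> C^o | phi \in schwartz_fun}.
Definition schwartz_val (phi : schwartz) : E -> C^o := sval phi.
HB.instance Definition _ := [isSub of schwartz for schwartz_val].
HB.instance Definition _ := [Choice of schwartz by <:].
HB.instance Definition _ := [SubChoice_isSubLmodule of schwartz by <:].

Definition schwartz_pderive i (phi : schwartz) : schwartz :=
  Sub (pderive i (val phi)) (schwartz_fun_pderive i (valP phi)).

Definition schwartz_translate x (phi : schwartz) : schwartz :=
  Sub (translate_fun x (val phi)) (schwartz_fun_translate x (valP phi)).

Definition seminorm (k : nat) s (phi : schwartz) : R :=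
  sup (weighted k s (val phi)).

End Schwartz.
Arguments schwartz R d : clear implicits.
Coercion schwartz_val : schwartz >-> Funclass.

Section Distributions.
Context {R : realType} {d : nat}.
Local Notation E := 'rV[R]_d.
Local Notation C := R[i].
Local Notation S := (schwartz R d).
Local Notation Re := complex.Re.
Local Notation Im := complex.Im.
Local Notation normc := Normc.normc.
Implicit Types (f g T : S -> C^o) (u : E -> C^o) (phi : S) (V : set E).

Definition cintegral (u : E -> C) : C :=
  let mu := lebesgue_tuple R d in
  ((\int[mu]_t Re (u (\row_i tnth t i))) +i*
   (\int[mu]_t Im (u (\row_i tnth t i))))%C.

(* A linear form on the Schwartz space is continuous iff it is bounded by
   finitely many of the seminorms that define the topology. *)
Definition tempered T := linear T /\
  exists (k : nat) (c : R), forall phi,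
    normc (T phi) <=
      c * \sum_(n < k.+1) \sum_(s : n.-tuple 'I_d) seminorm k s phi.

Definition regular_dist u : S -> C^o := fun phi =>
  cintegral (fun x => u x * phi x).

Definition dpderive (i : 'I_d) T : S -> C^o := fun phi =>
  - T (schwartz_pderive i phi).

Definition dpderives (s : seq 'I_d) T : S -> C^o := foldr dpderive T s.

Definition rapidly_decreasing T := tempered T /\
  forall k : nat, exists n (beta : 'I_n -> seq 'I_d) (u : 'I_n -> E -> C^o),
    (forall j, ccontinuous (u j) /\
      exists M : R, forall x, jbracket x ^+ k * normc (u j x) <= M) /\
    T = \sum_j dpderives (beta j) (regular_dist (u j)).

(* [<f * g, phi> = <g_x, <f_y, phi (x + y)>>]; for rapidly decreasing [f] the
   function paired with [g] is a Schwartz function, so that the default value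
   of [insubd] is not used. *)
Definition convolution f g : S -> C^o := fun phi =>
  g (insubd 0 (fun x => f (schwartz_translate x phi))).

Definition riesz_kernel (alpha : R) : E -> C^o :=
  fun x => (enorm x `^ (- alpha))%:C%C.

Definition riesz_potential (alpha : R) f : S -> C^o :=
  convolution f (regular_dist (riesz_kernel alpha)).

Definition tsupport u : set E := closure [set x | u x != 0].

Definition vanishes_on V T := forall phi,
  compact (tsupport phi) -> tsupport phi `<=` V -> T phi = 0.

End Distributions.

(* Main.v *)
(* Fix a test function phi supported near a point of V and let F be the Schwartz
   function x |-> f (phi (x + .)). Since f vanishes on V, F vanishes near 0, and
   since the Riesz potential vanishes on V, the integral of
   |z - y|^(-alpha) F(z) dz is zero for all small y. Differentiating in y under
   the integral sign, and using that the Laplacian of |x|^(-g) is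
   g (g + 2 - d) |x|^(-g-2) with nonzero constants for g = alpha + 2m, one finds
   that |z|^(-alpha) F(z) is orthogonal to every polynomial in the Kelvin
   transform z / |z|^2. The polynomials (1 - e |z - z0|^2 / |z|^2)^N concentrate
   at z0 as N grows, so F = 0. Thus f kills every translate of phi, and a smooth
   partition of unity by translates of small bumps gives f = 0. *)
From HB Require Import structures.
Require Import Defs.
From mathcomp Require Import all_boot all_order all_algebra.
From mathcomp Require Import all_classical all_reals all_analysis.
From mathcomp Require Import measurable_realfun complex ring lra.

Import Order.TTheory GRing.Theory Num.Theory.
Import numFieldNormedType.Exports.
Local Open Scope classical_set_scope.
Local Open Scope ring_scope.

Set Implicit Arguments.
Unset Strict Implicit.
Unset Printing Implicit Defensive.

(** * Lebesgue measure on row vectors *)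

(** Every derivative falls on the kernel and none on [F]. Since [F] vanishes near 0, the singularity
    of the kernel is never met when [y] is small, so the analytic core needs only a continuous,
    rapidly decaying real function [a], later the real or imaginary part of [F]. Two numbers are
    divided by along the way, alpha + 2m and alpha + 2m + 2 - d; they are the only source of the
    arithmetic condition on alpha. For alpha = d - 1 they are d - 1 + 2m and 2m + 1, both positive.
    With w = z / |z|^2 one has |z - z0|^2 / |z|^2 = 1 - 2 z0.w + |z0|^2 |w|^2. This polynomial in w
    is nonnegative and vanishes only at z0, so explicit powers do the work of a density theorem on
    an unbounded domain. The partition of unity has infinitely many pieces, whereas [f] is only
    finitely additive. One therefore splits off finitely many bumps and shows that the remaining
    tail is O(1/N) in every Schwartz seminorm. *)

Section RowMeasure.
Context {R : realType} {d : nat}.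
Local Notation E := 'rV[R]_d.

Definition row_of_tuple (t : d.-tuple R) : E := \row_i tnth t i.

Lemma measurable_ball_row (x : E) (e : R) : measurable (row_of_tuple @^-1` ball x e).
Proof.
have [e0|e0] := ltP 0 e; last first.
  rewrite (_ : _ @^-1` _ = set0)//; apply/seteqP; split => // t /= [].
  by rewrite ltNge e0.
rewrite (_ : _ @^-1` _ = \bigcap_(i in [set: 'I_d])
    [set t : d.-tuple R | ball (x 0 i) e (tnth t i)]); last first.
  apply/seteqP; split => t /=.
    by move=> [_ /= +] i _; move=> /(_ 0 i); rewrite mxE.
  move=> h; split => //= i j; rewrite ord1 mxE; exact: h.
apply: fin_bigcap_measurable => // i _; rewrite -[X in measurable X]setTI.
by apply: measurable_tnth => //; rewrite ball_itv; exact: measurable_itv.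
Qed.

(** Second countability: [B] enumerates, through [unpickle], the balls with rational centre and
    radius [1 / (n + 1)], with those not contained in [U] replaced by the empty set. *)
Lemma measurable_open_row (U : set E) : open U -> measurable (row_of_tuple @^-1` U).
Proof.
move=> oU.
pose B (k : nat) : set E := if unpickle k is Some (q, n) then
  let b := ball (map_mx ratr (q : 'rV[rat]_d) : E) (n.+1%:R^-1) in
  if `[< b `<=` U >] then b else set0 else set0.
have -> : U = \bigcup_k B k.
  apply/seteqP; split => [x Ux|x [k _]]; last first.
    rewrite /B; case: (unpickle k) => [[q n]|//] /=.
    by case: asboolP => // bU; exact: bU.
  have /nbhs_ballP[e /= e0 xeU] : nbhs x U by exact: open_nbhs_nbhs.
  have [n n_e] : exists n, n.+1%:R^-1 < e / 2.
    have [N _ HN] := near_infty_natSinv_lt (PosNum (divr_gt0 e0 (ltr0Sn R 1))).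
    by exists N; apply: HN => /=.
  have n0 : 0 < n.+1%:R^-1 :> R by rewrite invr_gt0.
  have /choice[q qx] : forall i, exists q : rat,
      ratr q \in `](x 0 i - n.+1%:R^-1), (x 0 i + n.+1%:R^-1)[.
    move=> i; have /rat_in_itvoo[q qi] : x 0 i - n.+1%:R^-1 < x 0 i + n.+1%:R^-1.
      by rewrite ltrD2l gtrN.
    by exists q.
  exists (pickle (\row_i q i, n)) => //; rewrite /B pickleK /=.
  have bx : ball (map_mx ratr (\row_i q i) : E) n.+1%:R^-1 x.
    split => //= i j; rewrite ord1 !mxE /ball/=.
    by move: (qx j); rewrite in_itv/= => /andP[h1 h2]; rewrite ltr_distl h1 h2.
  case: asboolP => //; case => y yb; apply: xeU.
  apply: (@ball_splitr _ _ (map_mx ratr (\row_i q i) : E)).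
    exact: (le_ball (ltW n_e) bx).
  exact: (le_ball (ltW n_e) yb).
rewrite preimage_bigcup; apply: bigcupT_measurable => k.
rewrite /B; case: (unpickle k) => [[q n]|] /=; last by rewrite preimage_set0.
case: ifPn => _; last by rewrite preimage_set0.
exact: measurable_ball_row.
Qed.

Lemma measurable_continuous_row (u : E -> R) : continuous u ->
  measurable_fun setT (u \o row_of_tuple).
Proof.
move=> cu; apply: (measurability _ (RGenOInfty.measurableE R)) => //.
move=> _ [_ [x ->] <-]; rewrite setTI comp_preimage.
by apply: measurable_open_row; apply: open_comp => // y _; exact: cu.
Qed.
End RowMeasure.

(** * Product structure and translation invariance of Lebesgue measure on tuples *)

Section TupleMeasure.
Context {R : realType}.
Local Notation leb := (@lebesgue_measure R).

Lemma lebesgue_tuple_consE n (A : set (n.+1.-tuple R)) :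
  lebesgue_tuple R n.+1 A = (leb \x lebesgue_tuple R n)%E (@consT R n @^-1` A).
Proof. by []. Qed.

Lemma ge0_integral_lebesgue_cons n (f : n.+1.-tuple R -> \bar R) :
  measurable_fun setT f -> (forall t, 0 <= f t)%E ->
  (\int[lebesgue_tuple R n.+1]_t f t =
   \int[leb]_x \int[lebesgue_tuple R n]_t f (consT (x, t)))%E.
Proof.
move=> mf f0.
have mc : @measurable_fun _ _ (measurableTypeR R * n.-tuple R)%type _ setT
  (@consT R n) := @measurable_consT R n.
transitivity (\int[(leb \x lebesgue_tuple R n)]_p (f \o @consT R n) p)%E.
  exact: (@ge0_integral_pushforward _ _ _ _ _ _ mc (leb \x lebesgue_tuple R n)%E setT).
rewrite fubini_tonelli1; [by []| |by move=> x; exact: f0].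
have mfc : measurable_fun setT (f \o @consT R n).
  by apply: measurableT_comp => //; exact: measurable_consT.
exact: mfc.
Qed.

Lemma measurable_tuple_prod (g : R -> R) n : measurable_fun setT g ->
  measurable_fun setT (fun t : n.-tuple R => (\prod_(i < n) g (tnth t i))%:E).
Proof.
move=> mg; apply/measurable_EFinP; apply: measurable_prod => i _.
by apply: measurableT_comp => //; exact: measurable_tnth.
Qed.

(** Tonelli, one coordinate at a time. It serves to reduce the integrability of the weight on the
    whole space to a one-dimensional integral. *)
Lemma ge0_integral_tuple_prod (g : R -> R) n :
  measurable_fun setT g -> (forall x, 0 <= g x) ->
  (\int[lebesgue_tuple R n]_t (\prod_(i < n) g (tnth t i))%:E =
   (\int[leb]_x (g x)%:E) ^+ n)%E.
Proof.
move=> mg g0.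
have mp k := measurable_tuple_prod (n := k) mg.
have p0 k (t : k.-tuple R) : (0 <= (\prod_(i < k) g (tnth t i))%:E)%E.
  by rewrite lee_fin; apply: prodr_ge0.
elim: n => [|n IH].
  by rewrite integral_dirac ?diracT ?mul1e ?big_ord0//; exact: mp.
rewrite ge0_integral_lebesgue_cons//.
have step (x : R) :
    (\int[lebesgue_tuple R n]_t (\prod_(i < n.+1) g (tnth (consT (x, t)) i))%:E =
    (g x)%:E * (\int[leb]_x (g x)%:E) ^+ n)%E.
  rewrite -IH -ge0_integralZl//; [|exact: mp|by rewrite lee_fin].
  apply: eq_integral => t _; rewrite -EFinM big_ord_recl /=; congr ((_ * _)%:E).
  by apply: eq_bigr => i _; rewrite tnthS.
transitivity (\int[leb]_x ((g x)%:E * (\int[leb]_x (g x)%:E) ^+ n))%E.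
  by apply: eq_integral => x _; exact: step.
rewrite ge0_integralZr//; first by rewrite expeS.
- exact/measurable_EFinP.
- by move=> x _; rewrite lee_fin.
- by rewrite expe_ge0// integral_ge0// => x _; rewrite lee_fin.
Qed.

Lemma lebesgue_measure_shift (c : R) (A : set R) : measurable A ->
  leb ((fun x => x + c) @^-1` A) = leb A.
Proof.
move=> mA.
have ms : @measurable_fun _ _ (measurableTypeR R) (measurableTypeR R) setT
  (fun x : R => x + c) by exact: measurable_funD.
apply/esym; apply: (@lebesgue_measure_unique R
  (measure_function_pushforward__canonical__measure_function_Measure leb ms)) => //.
move=> _ [[a b]] _ <- /=.
rewrite /pushforward (_ : _ @^-1` _ = `](a - c), (b - c)]%classic); last first.
  by apply/seteqP; split => x; rewrite /= !in_itv/= ltrBlDr lerBrDr.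
rewrite !lebesgue_measure_itv/= !lte_fin ltrD2r; case: ifP => // _.
by congr EFin; ring.
Qed.

Definition tuple_add n (y t : n.-tuple R) : n.-tuple R :=
  [tuple tnth t i + tnth y i | i < n].

Lemma measurable_tuple_add n (y : n.-tuple R) : measurable_fun setT (tuple_add y).
Proof.
apply/measurable_fun_tnthP => i.
rewrite [X in measurable_fun _ X](_ : _ = (fun t => tnth t i + tnth y i)); last first.
  by apply/funext => t; rewrite /= tnth_mktuple.
by apply: measurable_funD => //; exact: measurable_tnth.
Qed.

(** A translation acts on head and tail separately, so the translated product measure agrees with
    the original one on measurable rectangles, which determine it. *)
Lemma lebesgue_tuple_add n (y : n.-tuple R) (A : set (n.-tuple R)) : measurable A ->
  lebesgue_tuple R n (tuple_add y @^-1` A) = lebesgue_tuple R n A.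
Proof.
elim: n y A => [|n IH] y A mA.
  by congr (lebesgue_tuple R 0 _); apply/seteqP; split => t;
    by rewrite /preimage/= (tuple0 (tuple_add y t)) (tuple0 t).
rewrite !lebesgue_tuple_consE.
pose T (p : R * n.-tuple R) := (p.1 + thead y, tuple_add [tuple of behead y] p.2).
have mT : @measurable_fun _ _ (measurableTypeR R * n.-tuple R)%type
    (measurableTypeR R * n.-tuple R)%type setT T.
  apply: measurable_fun_pair.
    by apply: measurable_funD => //; exact: measurable_fst.
  exact: (measurableT_comp (measurable_tuple_add _) measurable_snd).
have -> : @consT R n @^-1` (tuple_add y @^-1` A) = T @^-1` (@consT R n @^-1` A).
  apply/seteqP; split => -[x t] /=; rewrite (_ : tuple_add y _ = consT (T (x, t)))//;
  apply/eq_from_tnth => i; case: (unliftP ord0 i) => [j|] ->;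
  by rewrite !tnth_mktuple /= ?tnthS ?tnth0 ?tnth_mktuple ?tnth_behead //;
    congr (_ + tnth _ _); apply/val_inj; rewrite /= inordK// ltnS.
have mB : measurable (@consT R n @^-1` A).
  by rewrite -[X in measurable X]setTI; exact: measurable_consT.
apply/esym; apply: (@product_measure_unique _ _ _ _ R leb (lebesgue_tuple R n)
  (measure_function_pushforward__canonical__measure_function_Measure
    (leb \x lebesgue_tuple R n)%E mT)) => // B C mB' mC /=; rewrite /pushforward.
rewrite (_ : _ @^-1` _ = ((fun x => x + thead y) @^-1` B) `*`
   (tuple_add [tuple of behead y] @^-1` C))//.
have mB1 : measurable ((fun x => x + thead y) @^-1` B).
  rewrite -[X in measurable X]setTI.
  have ms : measurable_fun setT (fun x : R => x + thead y) by exact: measurable_funD.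
  exact: ms.
have mC1 : measurable (tuple_add [tuple of behead y] @^-1` C).
  by rewrite -[X in measurable X]setTI; exact: measurable_tuple_add.
rewrite product_measure1E//; congr (_ * _)%E; last exact: IH.
exact: lebesgue_measure_shift.
Qed.
End TupleMeasure.

(** The integral over the positive half-line is known, and the reflection [x -> - x] carries the
    negative half-line to it. *)
Lemma integral_oneDsqrV_lty (R : realType) :
  (\int[@lebesgue_measure R]_x (oneDsqr x)^-1%:E < +oo)%E.
Proof.
have mf : measurable_fun setT (fun x : R => (oneDsqr x)^-1%:E).
  by apply/measurable_EFinP; apply: continuous_measurable_fun; exact: continuous_oneDsqrV.
have f0 (x : R) : (0 <= (oneDsqr x)^-1%:E)%E.
  by rewrite lee_fin invr_ge0 addr_ge0 ?sqr_ge0.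
have -> : setT = (`]-oo, 0%R] `|` `]0%R, +oo[)%classic :> set R.
  by rewrite -setCitvl setUv.
rewrite ge0_integral_setU//; [|exact: measurable_funTS|]; last first.
  by apply/disj_setPS => x /=; rewrite !in_itv/= andbT => -[h]; rewrite ltNge h.
rewrite (integral_itv_obnd_cbnd (r := 0%R)); last exact: measurable_funTS.
have -> : (\int[@lebesgue_measure R]_(x in `]-oo, 0%R]) (oneDsqr x)^-1%:E =
   \int[@lebesgue_measure R]_(x in `[0%R, +oo[) (oneDsqr x)^-1%:E)%E.
  rewrite ge0_integration_by_substitution0//.
  by apply: eq_integral => x _; rewrite /oneDsqr sqrrN.
by rewrite integral0y_oneDsqr -EFinD ltry.
Qed.

Lemma continuous_exprn (T : topologicalType) (R : realType) (f : T -> R) n x :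
  {for x, continuous f} -> {for x, continuous (fun y => f y ^+ n)}.
Proof.
by move=> cf; exact: (@continuous_comp _ _ _ f (fun t => t ^+ n) x cf
  (@exprn_continuous R n _)).
Qed.

(** * Integration over row vectors and the integrable weight *)

Section RowIntegral.
Context {R : realType} {d : nat}.
Local Notation E := 'rV[R]_d.
Local Notation mu := (lebesgue_tuple R d).
Implicit Types (u v : E -> R) (x y z : E).

Lemma jbracket_sqr x : jbracket x ^+ 2 = 1 + \sum_i x 0 i ^+ 2.
Proof.
have h0 : 0 <= \sum_i x 0 i ^+ 2 by apply: sumr_ge0 => i _; exact: sqr_ge0.
by rewrite sqr_sqrtr ?addr_ge0 ?sqr_ge0// /enorm sqr_sqrtr.
Qed.

Lemma jbracket_ge1 x : 1 <= jbracket x.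
Proof.
rewrite -(@ler_pXn2r _ 2)// ?nnegrE ?jbracket_ge0// jbracket_sqr expr1n lerDl.
by apply: sumr_ge0 => i _; exact: sqr_ge0.
Qed.

Lemma jbracket_gt0 x : 0 < jbracket x.
Proof. exact: lt_le_trans (jbracket_ge1 x). Qed.

Lemma continuous_coord i : continuous (fun x : E => x 0 i).
Proof. by move=> x; exact: coord_continuous. Qed.

Lemma continuous_sumsqr : continuous (fun x : E => \sum_i x 0 i ^+ 2).
Proof.
move=> x; rewrite (_ : (fun _ => _) = \sum_i (fun y : E => y 0 i ^+ 2)); last first.
  by apply/funext => y; rewrite fct_sumE.
apply: (big_ind (fun g : E -> R => {for x, continuous g})).
- exact: cst_continuous.
- by move=> g h cg ch; exact: continuousD.
- by move=> i _; apply: continuous_exprn; exact: continuous_coord.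
Qed.

Lemma continuous_enorm : continuous (@enorm R d).
Proof.
move=> x; apply: (@continuous_comp _ _ _ (fun x : E => \sum_i x 0 i ^+ 2) Num.sqrt).
  exact: continuous_sumsqr.
exact: sqrt_continuous.
Qed.

Lemma continuous_jbracket : continuous (@jbracket R d).
Proof.
move=> x; apply: (@continuous_comp _ _ _ (fun x : E => 1 + enorm x ^+ 2) Num.sqrt).
  apply: continuousD; first exact: cst_continuous.
  by apply: continuous_exprn; exact: continuous_enorm.
exact: sqrt_continuous.
Qed.

Definition row_measurable u := measurable_fun setT (u \o @row_of_tuple R d).
Definition row_integrable u := mu.-integrable setT (EFin \o (u \o @row_of_tuple R d)).
Definition row_int u : R := \int[mu]_t u (row_of_tuple t).

Lemma row_integrable_dom u v : row_measurable u -> row_integrable v ->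
  (forall x, `|u x| <= v x) -> row_integrable u.
Proof.
move=> mu_ iv uv; apply: le_integrable iv => //; first exact/measurable_EFinP.
by move=> t _ /=; rewrite lee_fin (le_trans (uv _))// ler_norm.
Qed.

Lemma row_integrableD u v : row_integrable u -> row_integrable v ->
  row_integrable (fun x => u x + v x).
Proof. by move=> iu iv; exact: (integrableD measurableT iu iv). Qed.

Lemma row_integrableZ c u : row_integrable u -> row_integrable (fun x => c * u x).
Proof. by move=> iu; exact: (integrableZl measurableT c iu). Qed.

Lemma row_intD u v : row_integrable u -> row_integrable v ->
  row_int (fun x => u x + v x) = row_int u + row_int v.
Proof. by move=> iu iv; exact: RintegralD. Qed.

Lemma row_intB u v : row_integrable u -> row_integrable v ->
  row_int (fun x => u x - v x) = row_int u - row_int v.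
Proof. by move=> iu iv; exact: RintegralB. Qed.

Lemma row_intZ c u : row_integrable u -> row_int (fun x => c * u x) = c * row_int u.
Proof. by move=> iu; exact: RintegralZl. Qed.

Lemma row_int0 : row_int (fun=> 0) = 0.
Proof. by rewrite /row_int Rintegral_cst// mul0r. Qed.

Lemma row_integrable_sum I (l : seq I) (F : I -> E -> R) :
  (forall i, row_integrable (F i)) -> row_integrable (fun x => \sum_(i <- l) F i x).
Proof.
move=> iF; elim: l => [|i l IH].
  rewrite (_ : (fun _ => _) = (fun=> 0)); first exact: integrable0.
  by apply/funext => x; rewrite big_nil.
rewrite (_ : (fun _ => _) = (fun x => F i x + \sum_(i <- l) F i x)).
  exact: row_integrableD.
by apply/funext => x; rewrite big_cons.
Qed.

Lemma row_int_sum I (l : seq I) (F : I -> E -> R) :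
  (forall i, row_integrable (F i)) ->
  row_int (fun x => \sum_(i <- l) F i x) = \sum_(i <- l) row_int (F i).
Proof.
move=> iF; elim: l => [|i l IH].
  by under eq_fun do rewrite big_nil; rewrite row_int0 big_nil.
under eq_fun do rewrite big_cons.
by rewrite row_intD ?IH ?big_cons//; exact: row_integrable_sum.
Qed.

Lemma row_int_le u v : row_integrable u -> row_integrable v ->
  (forall x, u x <= v x) -> row_int u <= row_int v.
Proof. by move=> iu iv uv; apply: le_Rintegral. Qed.

Lemma row_integrable_norm u : row_integrable u -> row_integrable (fun x => `|u x|).
Proof.
move=> iu; apply: le_integrable (iu) => //; last by move=> t _ /=; rewrite normr_id.
have /integrableP[/measurable_EFinP mu_ _] := iu.
by apply/measurable_EFinP; exact: (measurableT_comp (@normr_measurable R setT) mu_).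
Qed.

Lemma row_int_norm u v : row_integrable u -> row_integrable v ->
  (forall x, `|u x| <= v x) -> `|row_int u| <= row_int v.
Proof.
move=> iu iv uv; apply: (le_trans (le_normr_Rintegral measurableT iu)).
by apply: (@row_int_le (fun x => `|u x|) v) => //; exact: row_integrable_norm.
Qed.

(** This is (1 + |x|^2)^(-d), the common majorant in all dominated integrals below. *)
Definition jweight x : R := (jbracket x ^+ (2 * d))^-1.

Lemma row_measurable_continuous u : continuous u -> row_measurable u.
Proof. exact: measurable_continuous_row. Qed.

Lemma jweight_gt0 x : 0 < jweight x.
Proof. by rewrite invr_gt0 exprn_gt0 ?jbracket_gt0. Qed.

Lemma continuous_jweight : continuous jweight.
Proof.
move=> x; apply: (@continuousV _ _ (fun x => jbracket x ^+ (2 * d))).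
  by rewrite expf_neq0// gt_eqF ?jbracket_gt0.
by apply: continuous_exprn; exact: continuous_jbracket.
Qed.

(** Each 1 + x_i^2 is at most 1 + |x|^2, so the weight lies below the product of the one-dimensional
    functions 1 / (1 + x_i^2); no polar coordinates are needed. *)
Lemma row_integrable_jweight : row_integrable jweight.
Proof.
apply/integrableP; split.
  apply/measurable_EFinP; apply: row_measurable_continuous.
  exact: continuous_jweight.
have mg : measurable_fun setT (fun x : R => (oneDsqr x)^-1).
  by apply: continuous_measurable_fun; exact: continuous_oneDsqrV.
have g0 (x : R) : 0 <= (oneDsqr x)^-1 by rewrite invr_ge0 addr_ge0 ?sqr_ge0.
apply: (@le_lt_trans _ _
    (\int[mu]_t (\prod_(i < d) (oneDsqr (tnth t i))^-1)%:E)%E).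
  apply: ge0_le_integral => //.
  - do 2 apply: measurableT_comp => //.
    by apply: row_measurable_continuous; exact: continuous_jweight.
  - exact: (measurable_tuple_prod mg).
  move=> t _ /=; rewrite lee_fin ger0_norm; last exact: (ltW (jweight_gt0 _)).
  rewrite prodfV /jweight lef_pV2 ?posrE ?exprn_gt0 ?jbracket_gt0//; last first.
    by apply: prodr_gt0 => i _; rewrite ltr_pwDl// sqr_ge0.
  rewrite exprM -[X in _ ^+ X]card_ord -prodr_const; apply: ler_prod => i _.
  rewrite addr_ge0 ?sqr_ge0//= jbracket_sqr lerD2l (bigD1 i)//= mxE lerDl.
  by apply: sumr_ge0 => j _; exact: sqr_ge0.
rewrite (ge0_integral_tuple_prod _ mg g0).
rewrite -(@fineK _ (\int[_]_x _)%E) -?EFin_expe ?ltry//.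
rewrite ge0_fin_numE; first exact: integral_oneDsqrV_lty.
by apply: integral_ge0 => x _; rewrite lee_fin.
Qed.

Lemma row_integrable_bound u (c : R) : row_measurable u ->
  (forall x, `|u x| <= c * jweight x) -> row_integrable u.
Proof.
move=> mu_ h; apply: (row_integrable_dom mu_ _ h).
by apply: row_integrableZ; exact: row_integrable_jweight.
Qed.

Lemma row_of_tuple_add (y : E) (t : d.-tuple R) :
  row_of_tuple (tuple_add [tuple y 0 i | i < d] t) = row_of_tuple t + y.
Proof. by apply/rowP => i; rewrite !mxE !tnth_mktuple. Qed.

Lemma row_shift u y : row_integrable u ->
  row_integrable (fun x => u (x + y)) /\ row_int (fun x => u (x + y)) = row_int u.
Proof.
move=> iu.
pose w := [tuple y 0 i | i < d]; have mt := measurable_tuple_add w.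
have e (f : d.-tuple R -> \bar R) : (\int[pushforward mu (tuple_add w)]_t f t =
     \int[mu]_t f t)%E.
  by apply: eq_measure_integral => A mA _; exact: lebesgue_tuple_add.
have mu_ : measurable_fun setT (EFin \o (u \o @row_of_tuple R d)).
  by have /integrableP[] := iu.
have E1 : EFin \o ((fun x => u (x + y)) \o @row_of_tuple R d) =
    (EFin \o (u \o @row_of_tuple R d)) \o tuple_add w.
  by apply/funext => t /=; rewrite row_of_tuple_add.
have i1 : row_integrable (fun x => u (x + y)).
  rewrite /row_integrable E1; apply/integrableP; split.
    exact: measurableT_comp.
  have /integrableP[_] := iu.
  rewrite -(e (fun t => `|_|%E)) ge0_integral_pushforward//.
  exact: measurableT_comp.
split => //; rewrite /row_int /Rintegral; congr fine.
rewrite -[RHS]e (integral_pushforward mt mu_)//; last by rewrite preimage_setT -E1.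
by rewrite preimage_setT; apply: eq_integral => t _; rewrite /= row_of_tuple_add.
Qed.

(** For the maximum norm a ball is a cube of side [2 * e], which gives its exact volume. *)
Lemma row_int_ball u z (e c : R) : row_integrable u -> (forall x, 0 <= u x) ->
  0 < e -> 0 < c -> (forall x, ball z e x -> c <= u x) ->
  c * (2 * e) ^+ d <= row_int u.
Proof.
move=> iu u0 e0 c0 uc.
have vol : mu (@row_of_tuple R d @^-1` ball z e) = ((2 * e) ^+ d)%:E.
  rewrite (_ : _ @^-1` _ =
      [set t | forall i, `](z 0 i - e), (z 0 i + e)[%classic (tnth t i)]); last first.
    apply/seteqP; split => t /=.
      by move=> [_ /(_ 0)] h i; move: (h i); rewrite mxE ball_itv.
    by move=> h; split=> // i j; rewrite ord1 ball_itv mxE; exact: h.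
  pose I i : set R := `](z 0 i - e), (z 0 i + e)[%classic.
  transitivity (\prod_(i < d) lebesgue_measure (I i))%E.
    by apply: lebesgue_tuple_box => i; exact: measurable_itv.
  under eq_bigr => i _.
    rewrite lebesgue_measure_itv/= lte_fin ltrD2l gtrN// -EFinB.
    rewrite (_ : _ - _ = 2 * e); last by ring.
    over.
  by rewrite /= prodEFin prodr_const card_ord.
have mB : measurable (@row_of_tuple R d @^-1` ball z e) by exact: measurable_ball_row.
rewrite -lee_fin /row_int /Rintegral fineK; last exact: (integrable_fin_num measurableT iu).
rewrite EFinM -vol.
rewrite -(integral_cst _ mB).
apply: (@le_trans _ _ (\int[mu]_(t in @row_of_tuple R d @^-1` ball z e) (u (row_of_tuple t))%:E)%E).
  apply: ge0_le_integral => //=.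
  - by move=> *; rewrite lee_fin ltW.
  - by apply: measurable_funTS; have /integrableP[] := iu.
  - by move=> t ht; rewrite lee_fin; exact: uc.
apply: ge0_subset_integral => //.
  by have /integrableP[] := iu.
by move=> *; rewrite lee_fin.
Qed.
End RowIntegral.

(** * Moments against the derivatives of the Riesz kernel *)

Section Kernel.
Context {R : realType} {d : nat}.
Local Notation E := 'rV[R]_d.
Implicit Types (x y z w : E) (s : seq 'I_d) (g t : R) (i j : 'I_d).

Definition sqn x : R := \sum_i x 0 i ^+ 2.
Definition mon s x : R := \prod_(i <- s) x 0 i.
(** The function x^s |x|^(-g), with the exponent halved because [sqn] is |x|^2. Up to constants,
    such functions are closed under differentiation: a derivative either removes a factor x_i or
    adds one and raises g by 2. *)
Definition ker s g x : R := mon s x * sqn x `^ (- (g / 2)).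
Local Notation e_ i := (delta_mx 0 i : E).

Lemma sqn_ge0 x : 0 <= sqn x.
Proof. by apply: sumr_ge0 => i _; exact: sqr_ge0. Qed.

Lemma sqr_coord_le_sqn x i : x 0 i ^+ 2 <= sqn x.
Proof.
by rewrite /sqn (bigD1 i)//= lerDl; apply: sumr_ge0 => j _; exact: sqr_ge0.
Qed.

Lemma jbracket_sqn x : jbracket x ^+ 2 = 1 + sqn x.
Proof. exact: jbracket_sqr. Qed.

Lemma enorm_sqn x : enorm x = Num.sqrt (sqn x).
Proof. by []. Qed.

Lemma normr_row_lt x g : 0 < g -> `|x| < g <-> forall i, `|x 0 i| < g.
Proof.
move=> g0; have e : ball (0 : E) g x <-> `|x| < g.
  by rewrite -ball_normE /ball_ /= sub0r normrN.
split=> [/e[_ h] i|h].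
  by have := h 0 i; rewrite /ball/= mxE sub0r normrN.
by apply/e; split => // k i; rewrite ord1 /ball/= mxE sub0r normrN; exact: h.
Qed.

Lemma normr_delta_le1 i t : `|t *: e_ i| <= `|t|.
Proof.
rewrite normrZ ler_piMr//; apply/ler_addgt0Pr => e e0; apply: ltW.
apply/normr_row_lt => [|j]; first by rewrite addr_gt0.
rewrite mxE /=.
by case: eqP => _; rewrite ?normr1 ?normr0 ?ltrDl ?addr_gt0.
Qed.

Lemma sqn_ge_norm x g : 0 < g -> g <= `|x| -> g ^+ 2 <= sqn x.
Proof.
move=> g0; apply: contraTT; rewrite -!ltNge => h; apply/normr_row_lt => // i.
rewrite -(ltr_pXn2r (n := 2))// ?nnegrE ?ltW// real_normK ?num_real//.
exact: le_lt_trans (sqr_coord_le_sqn x i) h.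
Qed.

Lemma line_coordE w i j t : (w - t *: e_ i) 0 j = w 0 j - t * (i == j)%:R.
Proof. by rewrite !mxE eqxx /= eq_sym. Qed.

Lemma is_derive_line_coord w i j t :
  is_derive t (1 : R) (fun t => (w - t *: e_ i) 0 j) (- (i == j)%:R).
Proof.
rewrite (_ : (fun _ => _) = cst (w 0 j) - (i == j)%:R \*: id); last first.
  by apply/funext => u; rewrite line_coordE !fctE /= mulrC.
by apply: is_derive_eq; rewrite sub0r scaler1.
Qed.

(** The multiplicity makes the identity valid also when [i] does not occur in [s], where [rem]
    leaves [s] unchanged. *)
Lemma count_mon_rem s i x :
  (count_mem i s)%:R * (x 0 i * mon (rem i s) x) = (count_mem i s)%:R * mon s x.
Proof.
have [is_|/count_memPn ->] := boolP (i \in s); last by rewrite !mul0r.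
congr (_ * _); rewrite /mon -[LHS](big_cons _ _ _ _ xpredT).
by rewrite (perm_big _ (perm_to_rem is_)).
Qed.

Lemma is_derive_line_mon s w i t : is_derive t (1 : R) (fun t => mon s (w - t *: e_ i))
  (- ((count_mem i s)%:R * mon (rem i s) (w - t *: e_ i))).
Proof.
elim: s => [|j s IH].
  rewrite (_ : (fun _ => _) = cst 1); last by apply/funext => u; rewrite /mon big_nil.
  by apply: is_derive_eq; rewrite mul0r oppr0.
rewrite (_ : (fun _ => _) = (fun t => (w - t *: e_ i) 0 j) *
   (fun t => mon s (w - t *: e_ i))); last first.
  by apply/funext => u; rewrite /mon big_cons.
have dj := is_derive_line_coord w i j t.
apply: is_derive_eq; rewrite /= eq_sym.
case: eqVneq => [->|ji]; last first.
  rewrite oppr0 scaler0 addr0 add0n [in RHS]/mon big_cons -/(mon _ _) /GRing.scale /=.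
  by ring.
have := count_mon_rem s i (w - t *: e_ i); rewrite natrD /GRing.scale /=.
set c := (count_mem i s)%:R; set m := mon (rem i s) _; set x := (_ 0 i).
by move=> h; rewrite mulrN mulrCA h; ring.
Qed.

Lemma is_derive_line_sqn w i t : is_derive t (1 : R) (fun t => sqn (w - t *: e_ i))
  (- (2 * (w - t *: e_ i) 0 i)).
Proof.
rewrite (_ : (fun _ => _) = \sum_(j < d) (fun t => (w - t *: e_ i) 0 j) ^+ 2); last first.
  by apply/funext => u; rewrite fct_sumE; apply: eq_bigr => j _; rewrite fctE.
have dj j := is_derive_line_coord w i j t.
apply: is_derive_eq; rewrite (bigD1 i)//= big1; last first.
  by move=> j ji; rewrite eq_sym (negbTE ji) oppr0 scaler0.
by rewrite eqxx addr0 expr1 /GRing.scale /= mulrN mulr1.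
Qed.

Lemma is_derive_ker s g w i t : 0 < sqn (w - t *: e_ i) ->
  is_derive t (1 : R) (fun t => ker s g (w - t *: e_ i))
    (g * ker (i :: s) (g + 2) (w - t *: e_ i)
     - (count_mem i s)%:R * ker (rem i s) g (w - t *: e_ i)).
Proof.
move=> s0.
rewrite (_ : (fun _ => _) = (fun t => mon s (w - t *: e_ i)) *
   ((fun u : R => u `^ (- (g / 2))) \o (fun t => sqn (w - t *: e_ i)))); last first.
  by apply/funext => u.
have dm := is_derive_line_mon s w i t.
have dq := is_derive_line_sqn w i t.
have dp := is_derive1_powR (- (g / 2)) s0.
apply: is_derive_eq; rewrite /ker /mon big_cons -/(mon s _) -/(mon (rem i s) _).
rewrite (_ : - ((g + 2) / 2) = - (g / 2) - 1); last by field.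
by rewrite /GRing.scale /=; field.
Qed.

Lemma continuous_sqn : continuous sqn.
Proof. exact: continuous_sumsqr. Qed.

Lemma continuous_mon s : continuous (mon s).
Proof.
move=> x; elim: s => [|i s IH].
  rewrite (_ : mon [::] = cst 1); first exact: cst_continuous.
  by apply/funext => y; rewrite /mon big_nil.
rewrite (_ : mon (i :: s) = (fun x => x 0 i) \* mon s); last first.
  by apply/funext => y; rewrite /mon big_cons.
by apply: continuousM => //; exact: continuous_coord.
Qed.

Lemma row_measurableM (u v : E -> R) : row_measurable u -> row_measurable v ->
  row_measurable (fun x => u x * v x).
Proof. by move=> mu_ mv; exact: measurable_funM. Qed.

Lemma row_measurableD (u v : E -> R) : row_measurable u -> row_measurable v ->
  row_measurable (fun x => u x + v x).
Proof. by move=> mu_ mv; exact: measurable_funD. Qed.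

Lemma continuous_subr y : continuous (fun x : E => x - y).
Proof.
move=> x; apply: (continuousB (f := id) (g := cst y)); first exact: cvg_id.
exact: cst_continuous.
Qed.

Lemma row_measurable_ker s g y : row_measurable (fun x => ker s g (x - y)).
Proof.
apply: row_measurableM.
  apply: row_measurable_continuous => x.
  by apply: continuous_comp; [exact: continuous_subr|exact: continuous_mon].
apply: (measurableT_comp (measurable_powR (- (g / 2)))).
apply: (@row_measurable_continuous _ _ (fun x => sqn (x - y))) => x.
apply: (@continuous_comp _ _ _ (fun x => x - y) sqn); first exact: continuous_subr.
exact: continuous_sqn.
Qed.

Lemma coord_le_jbracket x i : `|x 0 i| <= jbracket x.
Proof.
rewrite -(ler_pXn2r (n := 2))// ?nnegrE ?jbracket_ge0// real_normK ?num_real//.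
by rewrite jbracket_sqn (le_trans (sqr_coord_le_sqn x i))// lerDr.
Qed.

Lemma mon_le_jbracket s x : `|mon s x| <= jbracket x ^+ size s.
Proof.
elim: s => [|i s IH]; first by rewrite /mon big_nil normr1.
rewrite /mon big_cons normrM exprS; apply: ler_pM => //.
exact: coord_le_jbracket.
Qed.

(** Away from the origin a negative power is bounded by its value at [m], and a nonnegative one is
    dominated by an integer power of 1 + |x|^2. *)
Lemma powR_sqn_le (m p : R) : 0 < m -> exists n : nat, forall x, m <= sqn x ->
  sqn x `^ p <= (m `^ p + 1) * jbracket x ^+ n.
Proof.
move=> m0; exists (2 * Num.bound `|p|)%N => x mx.
have J1 n : 1 <= jbracket x ^+ n by rewrite exprn_ege1// jbracket_ge1.
have m1 : 0 <= m `^ p by exact: powR_ge0.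
have s0 := lt_le_trans m0 mx.
have [p0|p0] := leP 0 p.
  apply: (@le_trans _ _ (jbracket x ^+ (2 * Num.bound `|p|))); last first.
    by rewrite ler_peMl ?exprn_ge0 ?jbracket_ge0// lerDr.
  apply: (@le_trans _ _ ((1 + sqn x) `^ p)).
    by apply: ge0_ler_powR; rewrite ?nnegrE ?addr_ge0 ?sqn_ge0// lerDr.
  rewrite exprM jbracket_sqn -powR_mulrn ?addr_ge0 ?sqn_ge0//.
  apply: ler_powR; first by rewrite lerDl sqn_ge0.
  by apply: ltW; rewrite -{1}(ger0_norm p0) archi_boundP.
apply: (@le_trans _ _ (m `^ p)); last first.
  apply: (@le_trans _ _ ((m `^ p + 1) * 1)); first by rewrite mulr1 lerDl.
  by rewrite ler_wpM2l// addr_ge0.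
rewrite -(opprK p) !(powRN _ (- p)) lef_pV2 ?posrE ?powR_gt0//.
by apply: ge0_ler_powR => //; rewrite ?nnegrE ?oppr_ge0; exact: ltW.
Qed.
End Kernel.

Section Core.
Context {R : realType} {d : nat}.
Local Notation E := 'rV[R]_d.
Local Notation e_ i := (delta_mx 0 i : E).
Implicit Types (x y z w : E) (s : seq 'I_d) (g t : R) (i j : 'I_d).
Context (a : E -> R) (ca : continuous a)
  (da : forall k : nat, exists M : R, forall x, jbracket x ^+ k * `|a x| <= M).
Context (r : R) (r0 : 0 < r) (a0 : forall x, `|x| < r -> a x = 0).
Local Notation rho := (r / 2).

Lemma jbracket_le x : `|x| < rho -> jbracket x <= 1 + d%:R * rho ^+ 2.
Proof.
have rho0 : 0 < rho by rewrite divr_gt0.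
move=> /(normr_row_lt _ rho0) h.
have c1 : 1 <= 1 + d%:R * rho ^+ 2 by rewrite lerDl mulr_ge0// sqr_ge0.
rewrite -(ler_pXn2r (n := 2))// ?nnegrE ?jbracket_ge0//; last exact: le_trans c1.
apply: (@le_trans _ _ (1 + d%:R * rho ^+ 2)); last by rewrite expr2 ler_peMl// (le_trans _ c1).
rewrite jbracket_sqn lerD2l /sqn mulr_natl -[X in _ *+ X]card_ord -sumr_const.
apply: ler_sum => i _; rewrite -[leLHS]real_normK ?num_real//.
by rewrite ler_pXn2r ?nnegrE ?(ltW rho0)// ltW.
Qed.

(** Where [a] is nonzero, |z| >= r, hence |z - y| >= r/2: the kernel stays off its singularity and
    grows polynomially, which the decay of [a] absorbs with [2 * d] powers to spare. The constant is
    independent of [y], as differentiation under the integral requires. *)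
Lemma ker_dom s g : exists C : R, forall y z, `|y| < rho ->
  `|ker s g (z - y) * a z| <= C * jweight z.
Proof.
have rho0 : 0 < rho by rewrite divr_gt0.
have [n hn] := powR_sqn_le (d := d) (- (g / 2)) (exprn_gt0 2 rho0).
set A := (rho ^+ 2) `^ (- (g / 2)) + 1 in hn.
have A0 : 0 <= A by rewrite addr_ge0 ?powR_ge0.
set N := (size s + n)%N.
have [M hM] := da (N + 2 * d).
set B := Num.sqrt 2 * (1 + d%:R * rho ^+ 2).
have B0 : 0 <= B by rewrite mulr_ge0 ?sqrtr_ge0// addr_ge0// mulr_ge0// sqr_ge0.
exists (A * B ^+ N * M) => y z hy.
have [zr|zr] := ltP `|z| r.
  rewrite a0// mulr0 normr0 mulr_ge0//; last exact: ltW (jweight_gt0 _).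
  rewrite mulr_ge0//; first by rewrite mulr_ge0 ?exprn_ge0.
  by apply: le_trans (hM 0); rewrite mulr_ge0 ?exprn_ge0 ?jbracket_ge0.
have hzy : rho ^+ 2 <= sqn (z - y).
  apply: sqn_ge_norm => //; rewrite -(lerD2r `|y|).
  apply: (@le_trans _ _ r); first by rewrite [leRHS]splitr lerD2l ltW.
  by apply: (le_trans zr); rewrite -{1}(subrK y z) ler_normD.
have J0 : 0 < jbracket z := jbracket_gt0 z.
have kb : `|ker s g (z - y)| <= A * (B * jbracket z) ^+ N.
  apply: (@le_trans _ _ (A * jbracket (z - y) ^+ N)).
    rewrite /ker normrM (ger0_norm (powR_ge0 _ _)) /N exprD mulrCA.
    by apply: ler_pM; rewrite ?powR_ge0 ?mon_le_jbracket ?hn.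
  have B1 : 0 <= B * jbracket z by rewrite mulr_ge0// jbracket_ge0.
  rewrite ler_wpM2l// lerXn2r ?nnegrE ?jbracket_ge0//.
  (* Peetre's inequality trades the weight at [z - y] for the weight at [z], the weight at [y] being
     bounded on the ball of radius r/2. *)
  apply: (le_trans (jbracket_translate y (z - y))).
  rewrite addrC subrK ler_wpM2r ?jbracket_ge0// ler_wpM2l ?sqrtr_ge0//.
  exact: jbracket_le.
rewrite normrM; apply: (@le_trans _ _ (A * (B * jbracket z) ^+ N * `|a z|)).
  by rewrite ler_wpM2r.
rewrite /jweight ler_pdivlMr ?exprn_gt0// exprMn.
rewrite [leLHS](_ : _ = A * B ^+ N * (jbracket z ^+ (N + 2 * d) * `|a z|)); last first.
  by rewrite exprD; ring.
by rewrite ler_wpM2l ?hM// mulr_ge0 ?exprn_ge0.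
Qed.

Lemma row_integrable_ker s g y : `|y| < rho ->
  row_integrable (fun z => ker s g (z - y) * a z).
Proof.
move=> hy; have [C hC] := ker_dom s g.
apply: (@row_integrable_bound _ _ _ C) => [|z]; last exact: hC.
apply: row_measurableM; first exact: row_measurable_ker.
exact: row_measurable_continuous.
Qed.

Definition moment s g y : R := row_int (fun z => ker s g (z - y) * a z).

(* Differentiate [moment s g] in direction [i] under the integral sign. *)
Lemma moment_rec s g i : (forall y, `|y| < rho -> moment s g y = 0) ->
  forall y, `|y| < rho ->
  g * moment (i :: s) (g + 2) y = (count_mem i s)%:R * moment (rem i s) g y.
Proof.
move=> h0 y hy.
have rho0 : 0 < rho by rewrite divr_gt0.
(* For |t| below this margin the shifted point [y + t *: e_ i] stays in the ball where the moments
   are known to vanish. *)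
pose dl := rho - `|y|; have dl0 : 0 < dl by rewrite subr_gt0.
have hyt t : `]-dl, dl[%classic t -> `|y + t *: e_ i| < rho.
  rewrite /= in_itv/= => ht.
  apply: (le_lt_trans (ler_normD _ _)); rewrite -ltrBrDl.
  by apply: (le_lt_trans (normr_delta_le1 i t)); rewrite ltr_norml.
pose f t (u : d.-tuple R) := let z := row_of_tuple u in
  ker s g (z - (y + t *: e_ i)) * a z.
have I0 : `]-dl, dl[%classic (0 : R) by rewrite /= in_itv/= dl0 oppr_lt0 dl0.
pose df t (z : E) := g * (ker (i :: s) (g + 2) (z - (y + t *: e_ i)) * a z)
  - (count_mem i s)%:R * (ker (rem i s) g (z - (y + t *: e_ i)) * a z).
have fd t (u : d.-tuple R) : `]-dl, dl[%classic t ->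
    is_derive t (1 : R) (f ^~ u) (df t (row_of_tuple u)).
  move=> ht; rewrite /f /df; set z := row_of_tuple u.
  (* Here [a z = 0], so the integrand is constantly 0 in [t] and the possible singularity of the
     kernel is harmless. *)
  have [zr|zr] := ltP `|z| r.
    rewrite (_ : (fun _ => _) = cst 0); last by apply/funext => v; rewrite a0// mulr0.
    by apply: is_derive_eq; rewrite a0// !mulr0 subr0.
  have s0 : 0 < sqn ((z - y) - t *: e_ i).
    apply: (lt_le_trans (exprn_gt0 2 rho0)); apply: sqn_ge_norm => //.
    rewrite -addrA -opprD -(lerD2r `|y + t *: e_ i|).
    apply: (@le_trans _ _ r).
      by rewrite [leRHS]splitr lerD2l ltW// hyt.
    by apply: (le_trans zr); rewrite -{1}(subrK (y + t *: e_ i) z) ler_normD.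
  rewrite (_ : (fun _ => _) = a z \*: (fun t => ker s g ((z - y) - t *: e_ i))); last first.
    apply/funext => v; transitivity (a z * ker s g (z - y - v *: e_ i)) => //.
    by rewrite mulrC opprD addrA.
  have dk := is_derive_ker s g s0.
  apply: is_derive_eq; rewrite /GRing.scale /= !opprD !addrA; ring.
have [C1 h1] := ker_dom (i :: s) (g + 2).
have [C2 h2] := ker_dom (rem i s) g.
pose G (u : d.-tuple R) : R :=
  (`|g| * `|C1| + (count_mem i s)%:R * `|C2|) * jweight (row_of_tuple u).
have intf t : `]-dl, dl[%classic t -> (lebesgue_tuple R d).-integrable setT (EFin \o f t).
  by move=> ht; exact: row_integrable_ker (hyt _ ht).
have derf t (u : d.-tuple R) : `]-dl, dl[%classic t -> setT u -> derivable (f ^~ u) t 1.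
  by move=> ht _; have [] := fd t u ht.
have G0 u : 0 <= G u.
  by rewrite mulr_ge0 ?addr_ge0 ?mulr_ge0// ltW// jweight_gt0.
have iG : (lebesgue_tuple R d).-integrable setT (EFin \o G).
  exact: (row_integrableZ _ row_integrable_jweight).
have fG t (u : d.-tuple R) : `]-dl, dl[%classic t -> setT u -> `|partial1of2 f t u| <= G u.
  move=> ht _; rewrite partial1of2E.
  have /@derive_val -> := fd t u ht.
  have jw := ltW (jweight_gt0 (row_of_tuple u)).
  rewrite /df /G mulrDl; apply: (le_trans (ler_normB _ _)); apply: lerD.
    rewrite normrM -mulrA ler_wpM2l//; apply: (le_trans (h1 _ _ (hyt _ ht))).
    by rewrite ler_wpM2r// ler_norm.
  rewrite normrM normr_nat -mulrA ler_wpM2l//; apply: (le_trans (h2 _ _ (hyt _ ht))).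
  by rewrite ler_wpM2r// ler_norm.
have := differentiation_under_integral measurableT I0 intf derf G0 iG fG.
(* The moment is zero for all small [t], so its derivative at 0 vanishes, and the integral of the
   differentiated kernel is the claimed identity. *)
have -> : derive1 (fun x' : R => \int[lebesgue_tuple R d]_(u in setT) f x' u) 0 = 0.
  rewrite derive1E (near_eq_derive (g := cst 0)) ?derive_cst// ?oner_neq0//.
  have : \forall t \near (0 : R), t \in `]-dl, dl[ by exact: near_in_itvoo.
  apply: filterS => t ht; exact: h0 (hyt _ ht).
move=> /esym; rewrite (_ : Rintegral _ _ _ = row_int (df 0)); last first.
  apply: eq_Rintegral => u _; rewrite partial1of2E.
  by have /@derive_val -> := fd 0 u I0.
have hy0 : `|y + 0 *: e_ i| < rho by exact: hyt.
rewrite row_intB; [|exact: row_integrableZ (row_integrable_ker _ _ hy0)..].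
rewrite !row_intZ; [|exact: row_integrable_ker..].
by rewrite scale0r addr0 => /eqP; rewrite subr_eq0 => /eqP.
Qed.

Context (alpha : R) (al0 : forall m, alpha + 2 * m%:R != 0)
  (ald : forall m, alpha + 2 * m%:R + 2 - d%:R != 0).
Context (ha : forall y, `|y| < rho -> moment [::] alpha y = 0).

Lemma ker_sum_sqr g x : 0 < sqn x ->
  \sum_i ker [:: i; i] (g + 2) x = ker [::] g x.
Proof.
move=> s0; rewrite /ker /mon big_nil mul1r.
under eq_bigr => i _ do rewrite !big_cons big_nil mulr1 -expr2.
rewrite -mulr_suml -/(sqn x) (_ : - (g / 2) = 1 - ((g + 2) / 2)); last by field.
by rewrite powRD ?powRr1 ?sqn_ge0// (gt_eqF s0)/= implybT.
Qed.

(* [K = |.|^(-g)] satisfies [Laplacian K = g * (g + 2 - d) * |.|^(-g-2)]. *)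
Lemma moment_nil0 (m : nat) y : `|y| < rho -> moment [::] (alpha + 2 * m%:R) y = 0.
Proof.
have rho0 : 0 < rho by rewrite divr_gt0.
elim: m y => [|m IH] y hy; first by rewrite mulr0 addr0; exact: ha.
rewrite (_ : _ + _ = alpha + 2 * m%:R + 2); last by rewrite -natr1; ring.
set g := alpha + 2 * m%:R in IH *.
have g0 : g != 0 by exact: al0.
(* First derivatives of the vanishing moment cost a division by [g]; [J2] then differentiates once
   more. *)
have J1 i z : `|z| < rho -> moment [:: i] (g + 2) z = 0.
  move=> hz; have := moment_rec i IH hz; rewrite /= mul0r => /eqP.
  by rewrite mulf_eq0 (negbTE g0) => /eqP.
have J2 i : (g + 2) * moment [:: i; i] (g + 2 + 2) y = moment [::] (g + 2) y.
  by rewrite (moment_rec i (J1 i) hy) /= eqxx mul1r.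
have S : \sum_i moment [:: i; i] (g + 2 + 2) y = moment [::] (g + 2) y.
  transitivity (row_int (fun z => \sum_i (ker [:: i; i] (g + 2 + 2) (z - y) * a z))).
    by rewrite row_int_sum// => i; exact: row_integrable_ker.
  apply: eq_Rintegral => u _; rewrite -mulr_suml.
  set z := row_of_tuple u; have [zr|zr] := ltP `|z| r; first by rewrite a0// !mulr0.
  rewrite ker_sum_sqr//; apply: (lt_le_trans (exprn_gt0 2 rho0)); apply: sqn_ge_norm => //.
  rewrite -(lerD2r `|y|); apply: (@le_trans _ _ r); first by rewrite [leRHS]splitr lerD2l ltW.
  by apply: (le_trans zr); rewrite -{1}(subrK y z) ler_normD.
(* Summing [J2] over the [d] directions and inserting [S] leaves [g + 2 - d] times the wanted
   moment, a factor that [ald] makes nonzero. *)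
have : (g + 2) * moment [::] (g + 2) y = d%:R * moment [::] (g + 2) y.
  rewrite -{1}S mulr_sumr (eq_bigr (fun=> moment [::] (g + 2) y)); last by move=> i _; exact: J2.
  by rewrite sumr_const card_ord mulr_natl.
move/eqP; rewrite -subr_eq0 -mulrBl mulf_eq0 => /orP[|/eqP//].
by rewrite (negbTE (ald m)).
Qed.

(** Differentiating the moment of [s] in direction [i] yields the moment of [i :: s] with exponent
    raised by 2, up to the moment of the shorter [rem i s], already zero. Each factor of the
    monomial thus uses up one unit of [m], which explains the bound on [size s]. *)
Lemma moment0 s (m : nat) y : (size s <= m)%N -> `|y| < rho ->
  moment s (alpha + 2 * m%:R) y = 0.
Proof.
have [n] := ubnP (size s); elim: n s m y => // n IH [|i s] m y sn sm hy.
  exact: moment_nil0.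
case: m sm => // m sm; rewrite ltnS in sm; rewrite ltnS in sn.
have h z : `|z| < rho -> moment s (alpha + 2 * m%:R) z = 0 by exact: IH.
have := moment_rec i h hy.
rewrite (_ : alpha + 2 * m%:R + 2 = alpha + 2 * m.+1%:R); last by rewrite -natr1; ring.
have [is_|/count_memPn ->] := boolP (i \in s).
  rewrite (IH (rem i s)) ?mulr0 ?size_rem ?(leq_ltn_trans (leq_pred _) sn)//; last first.
    exact: leq_trans (leq_pred _) sm.
  by move/eqP; rewrite mulf_eq0 (negbTE (al0 _)) => /eqP.
by rewrite mul0r => /eqP; rewrite mulf_eq0 (negbTE (al0 _)) => /eqP.
Qed.
End Core.

Lemma continuous_near_gt (T : topologicalType) (R : realType) (f : T -> R) x c :
  {for x, continuous f} -> c < f x -> \forall z \near x, c < f z.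
Proof. by move=> cf h; exact: (cvgr_gt _ cf). Qed.

(** * Polynomials in the Kelvin transform *)

Section Concentration.
Context {R : realType} {d : nat}.
Local Notation E := 'rV[R]_d.
Implicit Types (x y z : E) (s : seq 'I_d) (g h : E -> R) (i j : 'I_d).
Context (a : E -> R) (ca : continuous a)
  (da : forall k : nat, exists M : R, forall x, jbracket x ^+ k * `|a x| <= M).
Context (r : R) (r0 : 0 < r) (a0 : forall x, `|x| < r -> a x = 0).
Context (alpha : R) (al0 : forall m, alpha + 2 * m%:R != 0)
  (ald : forall m, alpha + 2 * m%:R + 2 - d%:R != 0).
Context (ha : forall y, `|y| < r / 2 -> moment a [::] alpha y = 0).

(* The coordinates of the Kelvin transform [z / |z|^2]. *)
Definition kelvin i z : R := z 0 i / sqn z.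
Definition kelvin_mon s z : R := \prod_(i <- s) kelvin i z.

Lemma row_measurable_kelvin i : row_measurable (kelvin i).
Proof.
apply: row_measurableM; first exact: row_measurable_continuous (@continuous_coord _ _ i).
rewrite (_ : (fun _ => _) = (fun z => sqn z `^ (-1))); last first.
  by apply/funext => z; rewrite powR_inv1// sqn_ge0.
apply: (measurableT_comp (measurable_powR (-1))).
exact: row_measurable_continuous (@continuous_sqn _ _).
Qed.

Lemma row_measurable_kelvin_mon s : row_measurable (kelvin_mon s).
Proof.
elim: s => [|i s IH].
  rewrite (_ : kelvin_mon _ = cst 1); first exact: measurable_cst.
  by apply/funext => z; rewrite /kelvin_mon big_nil.
rewrite (_ : kelvin_mon _ = (fun z => kelvin i z * kelvin_mon s z)).
  by apply: row_measurableM => //; exact: row_measurable_kelvin.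
by apply/funext => z; rewrite /kelvin_mon big_cons.
Qed.

Lemma sqn_gt0 z : r <= `|z| -> 0 < sqn z.
Proof. by move=> zr; apply: (lt_le_trans (exprn_gt0 2 r0)); exact: sqn_ge_norm. Qed.

Lemma kelvin_le i z : r <= `|z| -> `|kelvin i z| <= 1 + (r ^+ 2)^-1.
Proof.
move=> zr; have s0 := sqn_gt0 zr; have r20 := exprn_gt0 2 r0.
rewrite /kelvin normrM normfV (gtr0_norm s0).
apply: (@le_trans _ _ ((1 + sqn z) / sqn z)).
  rewrite ler_pM2r ?invr_gt0//; apply: (@le_trans _ _ (1 + z 0 i ^+ 2)); last first.
    by rewrite lerD2l sqr_coord_le_sqn.
  rewrite -[z 0 i ^+ 2]real_normK ?num_real//; move: (`|z 0 i|) => t; nra.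
rewrite mulrDl divff ?gt_eqF// mul1r addrC lerD2l lef_pV2 ?posrE//.
exact: sqn_ge_norm.
Qed.

Lemma kelvin_mon_le s z : r <= `|z| -> `|kelvin_mon s z| <= (1 + (r ^+ 2)^-1) ^+ size s.
Proof.
move=> zr; elim: s => [|i s IH]; first by rewrite /kelvin_mon big_nil normr1.
by rewrite /kelvin_mon big_cons normrM /= exprS ler_pM// kelvin_le.
Qed.

(** When the exponent is raised by exactly 2 per factor of the monomial, every z_i is paired with
    its own |z|^(-2). This is the case [m = size s] of [moment0]. *)
Lemma ker_kelvin s z : 0 < sqn z ->
  ker s (alpha + 2 * (size s)%:R) z = ker [::] alpha z * kelvin_mon s z.
Proof.
move=> s0; elim: s => [|i s IH].
  by rewrite /kelvin_mon big_nil mulr1 mulr0 addr0.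
rewrite /kelvin_mon big_cons mulrCA -IH /ker /mon big_cons /kelvin /=.
rewrite (_ : - ((alpha + _) / 2) = - ((alpha + 2 * (size s)%:R) / 2) + -1); last first.
  by rewrite -natr1; field.
rewrite powRD; last by rewrite (gt_eqF s0)/= implybT.
by rewrite powR_inv1 ?ltW//; ring.
Qed.

(** A bound on [h] for |z| >= r suffices because [a] vanishes inside; the Kelvin coordinates are
    unbounded near 0, so no more could be asked. *)
Lemma row_integrable_ker_mul h (C : R) : row_measurable h ->
  (forall z, r <= `|z| -> `|h z| <= C) ->
  row_integrable (fun z => ker [::] alpha z * h z * a z).
Proof.
move=> mh hC; have [D hD] := ker_dom da r0 a0 [::] alpha.
apply: (@row_integrable_bound _ _ _ (`|D| * `|C|)) => [|z].
  apply: row_measurableM; last exact: row_measurable_continuous.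
  apply: row_measurableM => //.
  have := row_measurable_ker [::] alpha (0 : E).
  by under eq_fun do rewrite subr0.
have jw := ltW (jweight_gt0 z).
have [zr|zr] := ltP `|z| r.
  by rewrite a0// mulr0 normr0 !mulr_ge0.
rewrite (_ : _ * a z = ker [::] alpha z * a z * h z); last by ring.
rewrite normrM [leRHS]mulrAC; apply: ler_pM => //.
  have := hD 0 z; rewrite subr0 normr0 divr_gt0// => /(_ isT) /le_trans; apply.
  by rewrite ler_wpM2r// ler_norm.
by apply: (le_trans (hC _ zr)); exact: ler_norm.
Qed.

(* [good g]: [g] times any polynomial in [z / |z|^2] is orthogonal to [|z|^(-alpha) a]. *)
Definition good g := row_measurable g /\ (exists C, forall z, r <= `|z| -> `|g z| <= C) /\
  forall s, row_int (fun z => ker [::] alpha z * (kelvin_mon s z * g z) * a z) = 0.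

Lemma row_integrable_good g s : good g ->
  row_integrable (fun z => ker [::] alpha z * (kelvin_mon s z * g z) * a z).
Proof.
case=> mg [[C gC] _].
apply: (@row_integrable_ker_mul _ ((1 + (r ^+ 2)^-1) ^+ size s * C)).
  by apply: row_measurableM => //; exact: row_measurable_kelvin_mon.
by move=> z zr; rewrite normrM ler_pM ?kelvin_mon_le ?gC.
Qed.

Lemma good_cst1 : good (fun=> 1).
Proof.
split; first exact: measurable_cst.
split; first by exists 1 => z _; rewrite normr1.
have rho0 : 0 < r / 2 by rewrite divr_gt0.
have n0 : `|0 : E| < r / 2 by rewrite normr0.
move=> s; rewrite -(moment0 ca da r0 a0 al0 ald ha (leqnn (size s)) n0).
apply: eq_Rintegral => u _; set z := row_of_tuple u; rewrite subr0.
have [zr|zr] := ltP `|z| r; first by rewrite a0// !mulr0.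
by rewrite ker_kelvin ?sqn_gt0// mulr1.
Qed.

Lemma good_lin (c e : R) g h : good g -> good h -> good (fun z => c * g z + e * h z).
Proof.
move=> Gg Gh; have [mg [[C gC] g0]] := Gg; have [mh [[D hD] h0]] := Gh.
split.
  by apply: row_measurableD; apply: row_measurableM => //; exact: measurable_cst.
split.
  exists (`|c| * C + `|e| * D) => z zr; apply: (le_trans (ler_normD _ _)).
  by rewrite !normrM lerD// ler_wpM2l// ?gC ?hD.
move=> s; rewrite (_ : (fun z => _) = (fun z =>
   c * (ker [::] alpha z * (kelvin_mon s z * g z) * a z) +
   e * (ker [::] alpha z * (kelvin_mon s z * h z) * a z))); last first.
  by apply/funext => z; ring.
rewrite row_intD; [|apply: row_integrableZ; exact: row_integrable_good..].
by rewrite !row_intZ ?g0 ?h0 ?mulr0 ?addr0//; exact: row_integrable_good.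
Qed.

Lemma good_kelvin i g : good g -> good (fun z => kelvin i z * g z).
Proof.
case=> mg [[C gC] g0]; split.
  by apply: row_measurableM => //; exact: row_measurable_kelvin.
split.
  by exists ((1 + (r ^+ 2)^-1) * C) => z zr; rewrite normrM ler_pM ?kelvin_le ?gC.
move=> s; rewrite -(g0 (i :: s)); congr row_int; apply/funext => z.
by rewrite /kelvin_mon big_cons; ring.
Qed.

Lemma good_sum I (l : seq I) (G : I -> E -> R) : (forall k, good (G k)) ->
  good (fun z => \sum_(k <- l) G k z).
Proof.
move=> gG; elim: l => [|i l IH].
  rewrite (_ : (fun _ => _) = (fun z => 0 * 1 + 0 * 1)); first exact: good_lin good_cst1 good_cst1.
  by apply/funext => z; rewrite big_nil !mul0r addr0.
rewrite (_ : (fun _ => _) = (fun z => 1 * G i z + 1 * \sum_(k <- l) G k z)).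
  exact: good_lin.
by apply/funext => z; rewrite big_cons !mul1r.
Qed.

Context (z0 : E).

(* Equals [|z - z0|^2 / |z|^2]. *)
Definition peak z : R := 1 - 2 * (\sum_i z0 0 i * kelvin i z)
  + sqn z0 * \sum_i kelvin i z ^+ 2.

Lemma sqn_sub z : sqn (z - z0) = sqn z - 2 * (\sum_i z0 0 i * z 0 i) + sqn z0.
Proof.
rewrite /sqn mulr_sumr -sumrB -big_split /=; apply: eq_bigr => i _.
by rewrite !mxE; ring.
Qed.

Lemma peakE z : 0 < sqn z -> peak z * sqn z = sqn (z - z0).
Proof.
move=> s0; rewrite sqn_sub /peak mulrDl mulrBl mul1r; congr (_ - _ + _).
  rewrite -mulrA mulr_suml; congr (_ * _); apply: eq_bigr => i _.
  by rewrite /kelvin mulrA divfK// gt_eqF.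
rewrite -mulrA mulr_suml (_ : \sum_(i < d) _ = 1) ?mulr1//.
rewrite (eq_bigr (fun i => z 0 i ^+ 2 / sqn z)); last first.
  by move=> i _; rewrite /kelvin; field; rewrite gt_eqF.
by rewrite -mulr_suml -/(sqn z) divff// gt_eqF.
Qed.

Lemma good_peak (e : R) g : good g -> good (fun z => (1 - e * peak z) * g z).
Proof.
move=> gg.
rewrite (_ : (fun _ => _) = (fun z => (1 - e) * g z + 1 * \sum_i
   ((2 * e * z0 0 i) * (kelvin i z * g z) +
    (- (e * sqn z0)) * (kelvin i z * (kelvin i z * g z))))); last first.
  apply/funext => z; rewrite big_split /= /peak.
  have -> : \sum_i 2 * e * z0 0 i * (kelvin i z * g z) =
      (\sum_i z0 0 i * kelvin i z) * (2 * e * g z).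
    by rewrite mulr_suml; apply: eq_bigr => i _; ring.
  have -> : \sum_i - (e * sqn z0) * (kelvin i z * (kelvin i z * g z)) =
      (\sum_i kelvin i z ^+ 2) * (- (e * sqn z0) * g z).
    by rewrite mulr_suml; apply: eq_bigr => i _; ring.
  by ring.
apply: good_lin => //; apply: good_sum => i.
by apply: good_lin; do ?[exact: good_kelvin|apply: good_kelvin].
Qed.

Lemma good_peakX (e : R) n : good (fun z => (1 - e * peak z) ^+ n).
Proof.
elim: n => [|n IH]; first by under eq_fun do rewrite expr0; exact: good_cst1.
by under eq_fun do rewrite exprS; exact: good_peak.
Qed.

(** Suppose [a z0 > 0] and integrate [b] = |z|^(-alpha) a against (1 - e * peak)^n, with result 0.
    Near [z0] the integrand is at least rho1^n c, and it can be negative only where the peak factor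
    is at most rho2^n with rho2 < rho1. Large [n] gives a contradiction. *)
Lemma decaying_vanishing_le0 : a z0 <= 0.
Proof.
rewrite leNgt; apply/negP => az0.
have z0r : r <= `|z0| by rewrite leNgt; apply/negP => /a0 h; rewrite h ltxx in az0.
have S0 := sqn_gt0 z0r; set S := sqn z0 in S0.
have r20 : 0 < r ^+ 2 by exact: exprn_gt0.
have sqn_sub_ge0 z := sqn_ge0 (z - z0).
have sub_le z : sqn (z - z0) <= 2 * sqn z + 2 * S.
  rewrite /S /sqn !mulr_sumr -big_split /=; apply: ler_sum => i _; rewrite !mxE.
  by have := sqr_ge0 (z 0 i + z0 0 i); move: (z 0 i) (z0 0 i) => p q; nra.
have le_sub z : sqn z <= 2 * sqn (z - z0) + 2 * S.
  rewrite /S /sqn !mulr_sumr -big_split /=; apply: ler_sum => i _; rewrite !mxE.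
  by have := sqr_ge0 (z 0 i - 2 * z0 0 i); move: (z 0 i) (z0 0 i) => p q; nra.
(* For |z| >= r the quotient |z - z0|^2 / |z|^2 is at most 2 + 2S / r^2, so this [e] keeps
   [1 - e * peak] between 0 and 1. *)
pose e := (2 + 2 * S / r ^+ 2)^-1.
have e0 : 0 < e by rewrite invr_gt0 addr_gt0// divr_gt0// mulr_gt0.
have e1 : e <= 1.
  rewrite invf_le1 ?addr_gt0 ?divr_gt0 ?mulr_gt0//.
  by have : 0 <= 2 * S / r ^+ 2 by [rewrite divr_ge0 ?mulr_ge0 ?ltW]; lra.
have peak_ge0 z : r <= `|z| -> 0 <= peak z.
  move=> zr; have s0 := sqn_gt0 zr.
  by rewrite -(pmulr_lge0 _ s0) peakE.
have peak_le z : r <= `|z| -> e * peak z <= 1.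
  move=> zr; have s0 := sqn_gt0 zr.
  rewrite /e mulrC ler_pdivrMr ?mul1r ?addr_gt0 ?divr_gt0 ?mulr_gt0//.
  rewrite -(ler_pM2r s0) peakE// (le_trans (sub_le z))// [leRHS]mulrDl lerD2l.
  rewrite mulrAC ler_pdivlMr//; apply: ler_wpM2l; first by rewrite mulr_ge0// ltW.
  exact: sqn_ge_norm.
have [eta /= eta0 heta] : exists2 eta : R, 0 < eta & forall z, ball z0 eta z -> 0 < a z.
  have /nbhs_ballP[eta /= eta0 h] : \forall z \near z0, 0 < a z.
    by apply: continuous_near_gt => //; exact: ca.
  by exists eta.
(* If peak < dl then |z - z0|^2 < dl (2 |z - z0|^2 + 2S). With dl < 1/4 this forces |z - z0|^2 < 4
   dl S < eta^2, so [z] lies where [a] is positive. *)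
pose dl := eta ^+ 2 / (4 * (eta ^+ 2 + 4 * S)).
have eta20 : 0 < eta ^+ 2 by exact: exprn_gt0.
have den0 : 0 < 4 * (eta ^+ 2 + 4 * S) by rewrite mulr_gt0// addr_gt0// mulr_gt0.
have dl0 : 0 < dl by rewrite divr_gt0.
have dl4 : dl < 1 / 4 by rewrite ltr_pdivrMr//; lra.
have dlS : 4 * dl * S < eta ^+ 2.
  have hdl : dl * (4 * (eta ^+ 2 + 4 * S)) = eta ^+ 2 by rewrite /dl divfK// gt_eqF.
  have h1 := mulr_gt0 dl0 eta20; have h2 := mulr_gt0 dl0 S0.
  by rewrite -[ltRHS]hdl; nra.
have near_z0 z : r <= `|z| -> peak z < dl -> 0 < a z.
  move=> zr; have s0 := sqn_gt0 zr.
  rewrite -(ltr_pM2r s0) peakE// => h; apply: heta; rewrite -ball_normE /ball_ /=.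
  rewrite distrC; apply/normr_row_lt => // i.
  rewrite -(ltr_pXn2r (n := 2))// ?nnegrE ?(ltW eta0)// real_normK ?num_real//.
  apply: (le_lt_trans (sqr_coord_le_sqn (z - z0) i)).
  have := le_sub z; have := sqn_sub_ge0 z.
  move: (sqn (z - z0)) (sqn z) h dlS dl4 dl0 => A B; nra.
pose b z := ker [::] alpha z * a z.
have kerp z : 0 < sqn z -> 0 < ker [::] alpha z.
  by move=> s0; rewrite /ker /mon big_nil mul1r powR_gt0.
have [c c0 [eta' eta'0 hb]] : exists2 c : R, 0 < c & exists2 eta' : R, 0 < eta' &
    forall z, ball z0 eta' z -> [/\ r <= `|z|, c <= b z & peak z < dl / 4].
  pose k z := sqn z `^ (- (alpha / 2)).
  have ck : {for z0, continuous k}.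
    apply: (@continuous_comp _ _ _ sqn (fun t => t `^ (- (alpha / 2)))).
      exact: continuous_sqn.
    apply: differentiable_continuous; apply/derivable1_diffP.
    by have [] := is_derive1_powR (- (alpha / 2)) S0.
  have k0 : 0 < k z0 by rewrite powR_gt0.
  exists (k z0 / 2 * (a z0 / 2)); first by rewrite mulr_gt0// divr_gt0.
  have nk : \forall z \near z0, k z0 / 2 < k z.
    by apply: continuous_near_gt => //; lra.
  have na : \forall z \near z0, a z0 / 2 < a z.
    by apply: continuous_near_gt; [exact: ca|lra].
  (* The inequality peak < dl / 4 with its denominator cleared, so that continuity of [sqn] is
     enough. *)
  have np : \forall z \near z0, 0 < dl / 4 * sqn z - sqn (z - z0).
    have cq : {for z0, continuous (fun z => dl / 4 * sqn z - sqn (z - z0))}.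
      apply: (@continuousB _ _ _ (fun z => dl / 4 * sqn z) (fun z => sqn (z - z0))).
        apply: (@continuousM _ _ (fun=> dl / 4) sqn); first exact: cst_continuous.
        exact: continuous_sqn.
      apply: (@continuous_comp _ _ _ (fun z => z - z0) sqn); first exact: continuous_subr.
      exact: continuous_sqn.
    apply: continuous_near_gt => //; rewrite subrr (_ : sqn 0 = 0).
      by rewrite subr0 mulr_gt0// divr_gt0.
    by rewrite /sqn big1// => i _; rewrite mxE expr0n.
  have /nbhs_ballP[eta' /= eta'0 h] : \forall z \near z0, k z0 / 2 < k z /\
      (a z0 / 2 < a z /\ 0 < dl / 4 * sqn z - sqn (z - z0)).
    exact: filterI nk (filterI na np).
  exists eta' => // z zb; have [/= hk [/= haz hp]] := h z zb.
  have az : 0 < a z by lra.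
  have zr : r <= `|z| by rewrite leNgt; apply/negP => /a0 h'; rewrite h' ltxx in az.
  split=> //.
    rewrite /b /ker /mon big_nil mul1r -/(k z).
    by apply: ler_pM; rewrite ?ltW// divr_gt0.
  by rewrite -(ltr_pM2r (sqn_gt0 zr)) peakE ?sqn_gt0//; lra.
(* The values of [1 - e * peak] at the levels peak = dl / 4 and peak = dl, which bound it below near
   [z0] and above away from [z0]. *)
pose rho1 := 1 - e * (dl / 4); pose rho2 := 1 - e * dl.
have rho20 : 0 <= rho2 by rewrite /rho2; nra.
have rho12 : rho2 < rho1 by rewrite /rho1 /rho2; nra.
have rho10 : 0 < rho1 by exact: le_lt_trans rho12.
have ib : row_integrable b.
  have := row_integrable_good [::] good_cst1; rewrite (_ : (fun z => _) = b)//.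
  by apply/funext => z; rewrite /kelvin_mon big_nil !mulr1.
have ibn : row_integrable (fun z => `|b z|) by exact: row_integrable_norm.
pose I := row_int (fun z => `|b z|).
pose V := (2 * eta') ^+ d.
have key n : rho1 ^+ n * c * V <= rho2 ^+ n * I.
  have Gn := good_peakX e n; have [_ [_ /(_ [::]) int0]] := Gn.
  have iGn := row_integrable_good [::] Gn.
  have pE : (fun z => ker [::] alpha z * (kelvin_mon [::] z * (1 - e * peak z) ^+ n) * a z) =
      (fun z => (1 - e * peak z) ^+ n * b z).
    by apply/funext => z; rewrite /kelvin_mon big_nil /b; ring.
  rewrite pE in int0 iGn.
  have := row_intD iGn (row_integrableZ (rho2 ^+ n) ibn).
  rewrite int0 add0r (row_intZ _ ibn) => <-.
  (* Adding [rho2 ^+ n * |b|] makes the integrand nonnegative everywhere: [b] can be negative only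
     where peak >= dl, and there the factor is at most rho2^n. The good part integrates to 0, so the
     total integral is rho2^n I. *)
  have lo z : (1 - e * peak z) ^+ n * b z + rho2 ^+ n * `|b z| >= 0 /\
     (ball z0 eta' z -> rho1 ^+ n * c <= (1 - e * peak z) ^+ n * b z + rho2 ^+ n * `|b z|).
    have rb0 : 0 <= rho2 ^+ n * `|b z| by rewrite mulr_ge0// exprn_ge0.
    have [zr|zr] := ltP `|z| r.
      split; first by rewrite /b a0// !mulr0 normr0 mulr0 addr0.
      by move=> /hb[]; rewrite leNgt zr.
    have f0 : 0 <= 1 - e * peak z by rewrite subr_ge0 peak_le.
    have [pz|pz] := ltP (peak z) dl.
      have b0 : 0 < b z by rewrite mulr_gt0 ?kerp ?sqn_gt0 ?near_z0.
      split; first by rewrite addr_ge0// mulr_ge0 ?exprn_ge0// ltW.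
      move=> /hb[_ cb pd]; rewrite -[leLHS]addr0 lerD// ler_pM ?exprn_ge0 ?(ltW rho10) ?(ltW c0)//.
      by rewrite lerXn2r ?nnegrE ?(ltW rho10)// lerB// ler_pM2l// ltW.
    split; last by move=> /hb[_ _ pd]; lra.
    rewrite -lerBlDr sub0r.
    apply: (@le_trans _ _ (- ((1 - e * peak z) ^+ n * `|b z|))).
      rewrite lerN2 ler_wpM2r// lerXn2r ?nnegrE// lerB// ler_pM2l//.
    by rewrite -mulrN ler_wpM2l ?exprn_ge0// lerNl -normrN ler_norm.
  apply: (@row_int_ball _ _ _ z0) => //.
  - by apply: row_integrableD => //; exact: row_integrableZ.
  - by move=> z; have [] := lo z.
  - by rewrite mulr_gt0 ?exprn_gt0.
  - by move=> z; have [_] := lo z.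
have V0 : 0 < c * V by rewrite mulr_gt0// exprn_gt0// mulr_gt0.
pose k := rho2 / rho1.
(* After division by rho1^n the bound reads c V <= k^n I with 0 <= k < 1, and k^n tends to 0. *)
have k0 : 0 <= k by rewrite divr_ge0// ltW.
have k1 : `|k| < 1 by rewrite ger0_norm// ltr_pdivrMr// mul1r.
have key2 n : c * V <= k ^+ n * I.
  rewrite /k expr_div_n mulrAC ler_pdivlMr ?exprn_gt0// mulrC mulrA.
  exact: key.
have I0 : 0 < I by have := key2 0%N; rewrite expr0 mul1r; exact: lt_le_trans.
have /cvgrPdist_lt /(_ (c * V / I)) := cvg_expr k1.
rewrite divr_gt0// => /(_ isT) [n _ /(_ n (leqnn n))] /=.
rewrite sub0r normrN ger0_norm ?exprn_ge0// ltr_pdivlMr// => /(le_lt_trans (key2 n)).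
by rewrite ltxx.
Qed.
End Concentration.

Lemma decaying_vanishing_eq0 (R : realType) (d : nat) (a : 'rV[R]_d -> R) (r alpha : R) :
  continuous a ->
  (forall k : nat, exists M : R, forall x, jbracket x ^+ k * `|a x| <= M) ->
  0 < r -> (forall x, `|x| < r -> a x = 0) ->
  (forall m, alpha + 2 * m%:R != 0) -> (forall m, alpha + 2 * m%:R + 2 - d%:R != 0) ->
  (forall y, `|y| < r / 2 -> moment a [::] alpha y = 0) -> forall z, a z = 0.
Proof.
move=> ca da r0 a0 al0 ald ha z; apply/eqP; rewrite eq_le; apply/andP; split.
  exact: (decaying_vanishing_le0 ca da r0 a0 al0 ald ha).
rewrite -oppr_le0.
apply: (@decaying_vanishing_le0 R d (fun x => - a x) _ _ r r0 _ alpha al0 ald _ z).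
- by move=> x; apply: continuousN; exact: ca.
- by move=> k; have [M hM] := da k; exists M => x; rewrite normrN.
- by move=> x xr; rewrite a0// oppr0.
move=> y yr; have := ha y yr; rewrite /moment => h.
under eq_fun do rewrite mulrN -mulN1r.
rewrite row_intZ; last exact: (row_integrable_ker ca da r0 a0).
by rewrite h mulr0.
Qed.

(** * Mollification by a rapidly decreasing distribution *)

Section Taylor.
Context {R : realType} {d : nat}.
Local Notation E := 'rV[R]_d.
Local Notation e_ i := (delta_mx 0 i : E).
Implicit Types (x y z h : E) (g psi : E -> R) (i j : 'I_d).

Lemma normr_coord_le x i : `|x 0 i| <= `|x|.
Proof.
apply/ler_addgt0Pr => e e0; apply: ltW.
have xe : 0 < `|x| + e by rewrite (lt_le_trans e0)// lerDr.
by apply: (proj1 (normr_row_lt x xe)); rewrite ltrDl.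
Qed.

(** A quadratic remainder identifies the differential outright, so differentiability and the values
    of all partial derivatives come from one estimate. *)
Lemma quadratic_differentiable g x (p : 'I_d -> R) (c : R) :
  (forall h, `|g (x + h) - g x - \sum_i h 0 i * p i| <= c * `|h| ^+ 2) ->
  differentiable g x /\ forall i, 'D_(e_ i) g x = p i.
Proof.
move=> gh; pose l h : R := \sum_i h 0 i * p i.
have l_lin : linear l.
  move=> k u v; rewrite /l scaler_sumr -big_split /=; apply: eq_bigr => i _.
  by rewrite !mxE /GRing.scale /=; ring.
pose lM := GRing.isLinear.Build _ _ _ _ _ l_lin.
pose L : {linear E -> R} := HB.pack l lM.
have cL : continuous L.
  move=> y; rewrite (_ : (L : E -> R) = \sum_i (fun h => h 0 i * p i)); last first.
    by apply/funext => h; rewrite fct_sumE.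
  apply: (big_ind (fun g : E -> R => {for y, continuous g})).
  - exact: cst_continuous.
  - by move=> g1 g2 c1 c2; exact: continuousD.
  - move=> i _; apply: (@continuousM _ _ (fun h : E => h 0 i) (fun=> p i)).
      exact: continuous_coord.
    exact: cst_continuous.
have oE : g \o shift x = cst (g x) + L +o_ (0 : E) id.
  apply/eqaddoP => _/posnumP[eps]; near=> h.
  rewrite !fctE /= (addrC h) opprD addrA; apply: (le_trans (gh h)).
  rewrite expr2 mulrA ler_wpM2r//.
  apply: (@le_trans _ _ (`|c| * `|h|)); first by rewrite ler_wpM2r// ler_norm.
  apply: (@le_trans _ _ ((`|c| + 1) * `|h|)); first by rewrite ler_wpM2r// lerDl.
  rewrite mulrC -ler_pdivlMr; last by rewrite ltr_wpDl.
  near: h; apply/nbhs_ballP; exists (eps%:num / (`|c| + 1)) => /=.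
    by rewrite divr_gt0// ltr_wpDl.
  by move=> y; rewrite -ball_normE /ball_ /= sub0r normrN; exact: ltW.
have dE := diff_unique cL oE.
have dg : differentiable g x by apply/diff_locallyP; rewrite dE.
split=> // i; rewrite deriveE// dE /= /l (bigD1 i)//= big1 ?addr0; last first.
  by move=> j ji; rewrite mxE /= (negbTE ji) mul0r.
by rewrite mxE /= !eqxx mul1r.
Unshelve. all: by end_near. Qed.

Lemma derive_row psi x h : differentiable psi x ->
  'D_h psi x = \sum_i h 0 i * 'D_(e_ i) psi x.
Proof.
move=> dp; rewrite deriveE// {1}(row_sum_delta h) linear_sum.
by apply: eq_bigr => i _; rewrite linearZ deriveE.
Qed.

Lemma is_derive_along psi x h (t : R) : differentiable psi (x + t *: h) ->
  is_derive t (1 : R) (fun t => psi (x + t *: h))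
    (\sum_i h 0 i * 'D_(e_ i) psi (x + t *: h)).
Proof.
move=> dp; rewrite -derive_row//; have dv := @diff_derivable _ _ _ _ _ h dp.
have eqf : (fun s : R => s^-1 *: ((((fun t => psi (x + t *: h)) \o shift t) (s *: (1 : R)) -
      psi (x + t *: h)))) =
    (fun s : R => s^-1 *: ((psi \o shift (x + t *: h)) (s *: h) - psi (x + t *: h))).
  apply/funext => s /=; congr (_ *: (psi _ - _)).
  by rewrite scalerDl addrCA [s *: 1]mulr1.
apply: DeriveDef.
  by move: dv; rewrite /derivable eqf.
by rewrite /derive eqf.
Qed.

Lemma lipschitz_bound psi (c : R) : (forall x, differentiable psi x) ->
  (forall x i, `|'D_(e_ i) psi x| <= c) ->
  forall x h, `|psi (x + h) - psi x| <= d%:R * c * `|h|.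
Proof.
move=> dp dc x h.
have [||t _] := @MVT_segment R (fun t => psi (x + t *: h))
  (fun t => \sum_i h 0 i * 'D_(e_ i) psi (x + t *: h)) 0 1 ler01.
- by move=> t _; apply: is_derive_along.
- apply: derivable_within_continuous => t _.
  by have [] := is_derive_along (dp (x + t *: h)).
rewrite scale1r scale0r addr0 subr0 mulr1 => ->.
apply: (le_trans (ler_norm_sum _ _ _)).
rewrite -mulrA mulr_natl -[X in _ *+ X]card_ord -sumr_const; apply: ler_sum => i _.
by rewrite normrM mulrC ler_pM// normr_coord_le.
Qed.

(** The mean value theorem on the segment turns the remainder into differences of first partials,
    each controlled by [lipschitz_bound]. Each factor [d] comes from summing coordinates that are
    bounded by the maximum norm. *)
Lemma taylor1 psi (c : R) : (forall x, differentiable psi x) ->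
  (forall x i, differentiable ('D_(e_ i) psi) x) ->
  (forall x i j, `|'D_(e_ j) ('D_(e_ i) psi) x| <= c) ->
  forall x h, `|psi (x + h) - psi x - \sum_i h 0 i * 'D_(e_ i) psi x| <=
    d%:R * (d%:R * c) * `|h| ^+ 2.
Proof.
move=> dp ddp dc x h.
have [||t t01] := @MVT_segment R (fun t => psi (x + t *: h))
  (fun t => \sum_i h 0 i * 'D_(e_ i) psi (x + t *: h)) 0 1 ler01.
- by move=> t _; apply: is_derive_along.
- apply: derivable_within_continuous => t _.
  by have [] := is_derive_along (dp (x + t *: h)).
rewrite scale1r scale0r addr0 subr0 mulr1 => ->; rewrite -sumrB.
apply: (le_trans (ler_norm_sum _ _ _)).
rewrite -!mulrA mulr_natl -[X in _ *+ X]card_ord -sumr_const; apply: ler_sum => i _.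
rewrite -mulrBr normrM expr2 !mulrA mulrC.
apply: ler_pM => //; last exact: normr_coord_le.
apply: (le_trans (lipschitz_bound (ddp^~ i) (fun x j => dc x i j) _ _)).
rewrite normrZ -!mulrA; apply: ler_wpM2l => //; apply: ler_wpM2l.
  by apply: le_trans (dc x i i).
rewrite ler_piMl//; move: t01; rewrite in_itv/= => /andP[t0 t1].
by rewrite ger0_norm.
Qed.
End Taylor.

Section RealConvolution.
Context {R : realType} {d : nat}.
Local Notation E := 'rV[R]_d.
Local Notation e_ i := (delta_mx 0 i : E).
Implicit Types (x y z h : E) (u psi : E -> R) (i j : 'I_d).

Lemma row_integrable_conv u psi (c m : R) x : continuous u -> continuous psi ->
  (forall y, `|u y| <= c * jweight y) -> (forall y, `|psi y| <= m) ->
  row_integrable (fun y => u y * psi (x + y)).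
Proof.
move=> cu cp uc pm; apply: (@row_integrable_bound _ _ _ (c * m)) => [|y].
  apply: row_measurable_continuous => y.
  apply: (@continuousM _ _ u (fun y => psi (x + y))); first exact: cu.
  apply: (@continuous_comp _ _ _ (fun y => x + y) psi); last exact: cp.
  by apply: (@continuousD _ _ _ (cst x) id); [exact: cst_continuous|exact: cvg_id].
by rewrite normrM mulrAC; apply: ler_pM.
Qed.

(** The Taylor remainder of [psi] is bounded by a multiple of |h|^2 uniformly in the base point, so
    it can be integrated against [u] and leaves a quadratic remainder for the convolution. *)
Lemma conv_differentiable u psi (c m b : R) x : continuous u ->
  (forall y, `|u y| <= c * jweight y) ->
  (forall y, differentiable psi y) -> (forall y, `|psi y| <= m) ->
  (forall y i, differentiable ('D_(e_ i) psi) y) ->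
  (forall y i, `|'D_(e_ i) psi y| <= m) ->
  (forall y i j, `|'D_(e_ j) ('D_(e_ i) psi) y| <= b) ->
  differentiable (fun x => row_int (fun y => u y * psi (x + y))) x /\
  forall i, 'D_(e_ i) (fun x => row_int (fun y => u y * psi (x + y))) x =
    row_int (fun y => u y * 'D_(e_ i) psi (x + y)).
Proof.
move=> cu uc dp pm ddp dpm ddb.
have cp : continuous psi by move=> y; exact: differentiable_continuous.
have cdp i : continuous ('D_(e_ i) psi) by move=> y; exact: differentiable_continuous.
have ip z := row_integrable_conv z cu cp uc pm.
have idp i z := row_integrable_conv z cu (cdp i) uc (dpm^~ i).
pose D := d%:R * (d%:R * b).
apply: (@quadratic_differentiable _ _ _ _ _ (row_int (fun y => c * D * jweight y))) => h.
have iS : row_integrable (fun y => \sum_i h 0 i * (u y * 'D_(e_ i) psi (x + y))).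
  by apply: row_integrable_sum => i; exact: row_integrableZ.
have i1 : row_integrable (fun y => u y * psi (x + h + y) + -1 * (u y * psi (x + y))).
  by apply: row_integrableD => //; exact: row_integrableZ.
rewrite (_ : _ - _ - _ = row_int (fun y => (u y * psi (x + h + y) + -1 * (u y * psi (x + y)))
   + -1 * (\sum_i h 0 i * (u y * 'D_(e_ i) psi (x + y))))); last first.
  rewrite row_intD//; last exact: row_integrableZ.
  rewrite row_intD//; last exact: row_integrableZ.
  rewrite !row_intZ// row_int_sum; last by move=> i; exact: row_integrableZ.
  rewrite !mulN1r; congr (_ - _ - _); apply: eq_bigr => i _.
  by rewrite row_intZ.
have iw : row_integrable (fun y => c * D * jweight y).
  by apply: row_integrableZ; exact: row_integrable_jweight.
rewrite mulrC -row_intZ//.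
apply: row_int_norm.
- by apply: row_integrableD => //; exact: row_integrableZ.
- exact: row_integrableZ.
move=> y; rewrite (_ : _ + _ = u y * (psi ((x + y) + h) - psi (x + y) -
    \sum_i h 0 i * 'D_(e_ i) psi (x + y))); last first.
  rewrite [RHS]mulrBr [X in _ = X - _]mulrBr [in RHS]mulr_sumr !mulN1r.
  rewrite (addrAC x h y); congr (_ - _ - _).
  by apply: eq_bigr => i _; ring.
rewrite normrM (_ : _ * (c * D * _) = (c * jweight y) * (D * `|h| ^+ 2)); last by ring.
by apply: ler_pM => //; exact: taylor1.
Qed.

(** By Peetre's inequality the weight at [x] splits into weights at [y] and at [x + y]. Of the
    [k + 2 * d] powers available for [u], [k] pay for this and [2 * d] produce the integrable
    weight. *)
Lemma conv_decay u psi (k : nat) (c m : R) x : continuous u -> continuous psi ->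
  (forall y, jbracket y ^+ (k + 2 * d) * `|u y| <= c) ->
  (forall y, jbracket y ^+ k * `|psi y| <= m) ->
  jbracket x ^+ k * `|row_int (fun y => u y * psi (x + y))| <=
    row_int (fun y => Num.sqrt 2 ^+ k * (c * m) * jweight y).
Proof.
move=> cu cp uc pm.
have j0 (y : E) n : 0 < jbracket y ^+ n by rewrite exprn_gt0// jbracket_gt0.
have uw y : `|u y| <= c * jweight y.
  rewrite /jweight ler_pdivlMr ?j0// mulrC; apply: le_trans (uc y).
  by rewrite ler_wpM2r// ler_weXn2l ?jbracket_ge1// leq_addl.
have pw y : `|psi y| <= m.
  apply: le_trans (pm y); rewrite ler_peMl// exprn_ege1// jbracket_ge1//.
have ic := row_integrable_conv x cu cp uw pw.
rewrite -[X in X * _]ger0_norm ?(ltW (j0 _ _))// -normrM -row_intZ//.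
apply: row_int_norm.
- exact: row_integrableZ.
- by apply: row_integrableZ; exact: row_integrable_jweight.
move=> y; rewrite normrM ger0_norm ?(ltW (j0 _ _))//.
have peetre : jbracket x ^+ k <= (Num.sqrt 2 * jbracket y * jbracket (x + y)) ^+ k.
  rewrite lerXn2r ?nnegrE ?mulr_ge0 ?sqrtr_ge0 ?jbracket_ge0//.
  by rewrite (addrC x); exact: jbracket_translate.
apply: (le_trans (ler_wpM2r (normr_ge0 _) peetre)).
rewrite !exprMn normrM.
rewrite [leLHS](_ : _ = Num.sqrt 2 ^+ k * ((jbracket y ^+ k * `|u y|) *
   (jbracket (x + y) ^+ k * `|psi (x + y)|))); last by ring.
rewrite -!mulrA ler_wpM2l ?exprn_ge0 ?sqrtr_ge0//.
rewrite [leRHS](_ : _ = (c * jweight y) * m); last by ring.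
rewrite mulrA; apply: ler_pM; rewrite ?mulr_ge0 ?(ltW (j0 _ _))//.
rewrite /jweight ler_pdivlMr ?j0// mulrAC -exprD; exact: uc.
Qed.
End RealConvolution.

(** * Convolution of a decaying density with derivatives of a Schwartz function *)

Section Mollification.
Context {R : realType} {d : nat}.
Local Notation E := 'rV[R]_d.
Local Notation C := R[i].
Local Notation S := (schwartz R d).
Local Notation e_ i := (delta_mx 0 i : E).
Local Notation Re := complex.Re.
Local Notation Im := complex.Im.
Local Notation normc := Normc.normc.
Implicit Types (x y z : E) (u : E -> C^o) (phi : S) (s : seq 'I_d) (i j : 'I_d).

Lemma normr_Re_le (c : C) : `|Re c| <= normc c.
Proof.
case: c => a b /=; rewrite -sqrtr_sqr ler_wsqrtr// lerDl; exact: sqr_ge0.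
Qed.

Lemma normr_Im_le (c : C) : `|Im c| <= normc c.
Proof.
case: c => a b /=; rewrite -sqrtr_sqr ler_wsqrtr// lerDr; exact: sqr_ge0.
Qed.

Lemma normc_le_sum (c : C) : normc c <= `|Re c| + `|Im c|.
Proof.
case: c => a b /=; rewrite -[leRHS]ger0_norm ?addr_ge0// -sqrtr_sqr ler_wsqrtr//.
rewrite sqrrD !real_normK ?num_real// lerD2r lerDl.
by rewrite mulrn_wge0// mulr_ge0.
Qed.

Lemma schwartz_smooth phi : smooth phi.
Proof. by have /schwartz_funP[] := valP phi. Qed.

Lemma schwartz_bound phi k s :
  exists M : R, forall x, jbracket x ^+ k * normc (pderives s phi x) <= M.
Proof.
have /schwartz_funP[_ /(_ k s)[M hM]] := valP phi.
by exists M => x; apply: hM; exists x.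
Qed.

Lemma schwartz_bound0 phi s : exists M : R, forall x, normc (pderives s phi x) <= M.
Proof.
by have [M hM] := schwartz_bound phi 0 s; exists M => x; have := hM x; rewrite expr0 mul1r.
Qed.

Lemma bounds_finType (I : finType) (T : Type) (F : I -> T -> R) :
  (forall k, exists M : R, forall t, F k t <= M) ->
  exists M : R, forall k t, F k t <= M.
Proof.
move=> /choice[M hM]; exists (\sum_k `|M k|) => k t.
apply: (le_trans (hM k t)); apply: (le_trans (ler_norm _)).
by rewrite (bigD1 k)//= lerDl sumr_ge0.
Qed.

Definition cconv u (psi : E -> C^o) : E -> C^o :=
  fun x => cintegral (fun y => u y * psi (x + y)).

Context (u : E -> C^o) (k : nat) (cu : ccontinuous u)
  (du : exists M : R, forall x, jbracket x ^+ (k + 2 * d) * normc (u x) <= M).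

Lemma weighted_density : exists c : R, forall x, normc (u x) <= c * jweight x.
Proof.
have [M hM] := du; exists M => x.
rewrite /jweight ler_pdivlMr ?exprn_gt0 ?jbracket_gt0// mulrC.
apply: le_trans (hM x); rewrite ler_wpM2r ?normc_ge0//.
by rewrite ler_weXn2l ?jbracket_ge1// leq_addl.
Qed.

Lemma continuous_pderives phi s : ccontinuous (pderives s phi).
Proof.
by split=> x; have [dr di] := schwartz_smooth phi s x; exact: differentiable_continuous.
Qed.

Lemma complex_ReM (a b : C) : Re (a * b) = Re a * Re b - Im a * Im b.
Proof. by case: a b => [? ?] [? ?]. Qed.

Lemma complex_ImM (a b : C) : Im (a * b) = Re a * Im b + Im a * Re b.
Proof. by case: a b => [? ?] [? ?]. Qed.

Lemma cconvE phi s x : let psi := pderives s phi in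
  Re (cconv u psi x) = row_int (fun y => Re (u y) * Re (psi (x + y)))
     - row_int (fun y => Im (u y) * Im (psi (x + y))) /\
  Im (cconv u psi x) = row_int (fun y => Re (u y) * Im (psi (x + y)))
     + row_int (fun y => Im (u y) * Re (psi (x + y))).
Proof.
move=> psi; have [c hc] := weighted_density; have [m hm] := schwartz_bound0 phi s.
have [cur cui] := cu; have [cpr cpi] := continuous_pderives phi s.
have hcr y : `|Re (u y)| <= c * jweight y by exact: le_trans (normr_Re_le _) (hc y).
have hci y : `|Im (u y)| <= c * jweight y by exact: le_trans (normr_Im_le _) (hc y).
have hmr y : `|Re (psi y)| <= m by exact: le_trans (normr_Re_le _) (hm y).
have hmi y : `|Im (psi y)| <= m by exact: le_trans (normr_Im_le _) (hm y).
have irr := row_integrable_conv x cur cpr hcr hmr.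
have iri := row_integrable_conv x cur cpi hcr hmi.
have iir := row_integrable_conv x cui cpr hci hmr.
have iii := row_integrable_conv x cui cpi hci hmi.
split.
  by rewrite -row_intB//; apply: eq_Rintegral => t _; rewrite complex_ReM.
by rewrite -row_intD//; apply: eq_Rintegral => t _; rewrite complex_ImM.
Qed.

Lemma cconv_pderive phi s :
  cdifferentiable (cconv u (pderives s phi)) /\
  forall i, pderive i (cconv u (pderives s phi)) = cconv u (pderives (i :: s) phi).
Proof.
have [c hc] := weighted_density; have [cur cui] := cu.
have hcr y : `|Re (u y)| <= c * jweight y by exact: le_trans (normr_Re_le _) (hc y).
have hci y : `|Im (u y)| <= c * jweight y by exact: le_trans (normr_Im_le _) (hc y).
have [m0 hm0] := schwartz_bound0 phi s.
have [m1 hm1] : exists M : R, forall i x, normc (pderives (i :: s) phi x) <= M.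
  by apply: bounds_finType => i; exact: schwartz_bound0.
have [b hb] : exists M : R, forall (ij : 'I_d * 'I_d) x,
    normc (pderives [:: ij.1, ij.2 & s] phi x) <= M.
  by apply: bounds_finType => ij; exact: schwartz_bound0.
pose m := `|m0| + `|m1|.
have hm y : normc (pderives s phi y) <= m.
  by apply: (le_trans (hm0 y)); apply: (le_trans (ler_norm _)); rewrite lerDl.
have hm' i y : normc (pderives (i :: s) phi y) <= m.
  by apply: (le_trans (hm1 i y)); apply: (le_trans (ler_norm _)); rewrite lerDr.
have sm := schwartz_smooth phi.
pose pr x := Re (pderives s phi x); pose pi x := Im (pderives s phi x).
have D (v : E -> R) (psi : E -> R) : continuous v -> (forall y, `|v y| <= c * jweight y) ->
    psi = pr \/ psi = pi -> forall x,
    differentiable (fun x => row_int (fun y => v y * psi (x + y))) x /\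
    forall i, 'D_(e_ i) (fun x => row_int (fun y => v y * psi (x + y))) x =
      row_int (fun y => v y * 'D_(e_ i) psi (x + y)).
  move=> cv hv [] -> x; apply: (conv_differentiable (m := m) (b := b) x cv hv).
  - by move=> y; have [] := sm s y.
  - by move=> y; exact: le_trans (normr_Re_le _) (hm y).
  - by move=> y i; have [] := sm (i :: s) y.
  - by move=> y i; exact: le_trans (normr_Re_le _) (hm' i y).
  - by move=> y i j; exact: le_trans (normr_Re_le _) (hb (j, i) y).
  - by move=> y; have [] := sm s y.
  - by move=> y; exact: le_trans (normr_Im_le _) (hm y).
  - by move=> y i; have [] := sm (i :: s) y.
  - by move=> y i; exact: le_trans (normr_Im_le _) (hm' i y).
  - by move=> y i j; exact: le_trans (normr_Im_le _) (hb (j, i) y).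
have reE : (fun x => Re (cconv u (pderives s phi) x)) =
    (fun x => row_int (fun y => Re (u y) * pr (x + y))) -
    (fun x => row_int (fun y => Im (u y) * pi (x + y))).
  by apply/funext => x; have [-> _] := cconvE phi s x.
have imE : (fun x => Im (cconv u (pderives s phi) x)) =
    (fun x => row_int (fun y => Re (u y) * pi (x + y))) +
    (fun x => row_int (fun y => Im (u y) * pr (x + y))).
  by apply/funext => x; have [_ ->] := cconvE phi s x.
have [Drr Drr'] := all_and2 (D _ _ cur hcr (or_introl erefl)).
have [Dri Dri'] := all_and2 (D _ _ cur hcr (or_intror erefl)).
have [Dir Dir'] := all_and2 (D _ _ cui hci (or_introl erefl)).
have [Dii Dii'] := all_and2 (D _ _ cui hci (or_intror erefl)).
split.
  by move=> x; rewrite reE imE; split; [exact: differentiableB|exact: differentiableD].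
move=> i; apply/funext => x; apply/eqP; rewrite eq_complex.
have [-> ->] := cconvE phi (i :: s) x.
rewrite {1}/pderive /= reE imE.
rewrite deriveB; [|exact: diff_derivable..].
rewrite deriveD; [|exact: diff_derivable..].
by rewrite Drr' Dri' Dir' Dii' !eqxx.
Qed.

Lemma pderives_cconv phi s s' :
  pderives s' (cconv u (pderives s phi)) = cconv u (pderives (s' ++ s) phi).
Proof.
elim: s' => //= i s' ->; have [_ ->] := cconv_pderive phi (s' ++ s).
by [].
Qed.

Lemma smooth_cconv phi s : smooth (cconv u (pderives s phi)).
Proof. by move=> s'; rewrite pderives_cconv; have [] := cconv_pderive phi (s' ++ s). Qed.

Lemma cconv_decay phi s : exists M : R, forall x,
  jbracket x ^+ k * normc (cconv u (pderives s phi) x) <= M.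
Proof.
have [c hc] := du; have [m hm] := schwartz_bound phi k s; have [cur cui] := cu.
have [cpr cpi] := continuous_pderives phi s.
have w0 y n : 0 <= jbracket y ^+ n :> R by rewrite exprn_ge0 ?jbracket_ge0.
have hcr y : jbracket y ^+ (k + 2 * d) * `|Re (u y)| <= c.
  by apply: le_trans (hc y); rewrite ler_wpM2l ?normr_Re_le.
have hci y : jbracket y ^+ (k + 2 * d) * `|Im (u y)| <= c.
  by apply: le_trans (hc y); rewrite ler_wpM2l ?normr_Im_le.
have hmr y : jbracket y ^+ k * `|Re (pderives s phi y)| <= m.
  by apply: le_trans (hm y); rewrite ler_wpM2l ?normr_Re_le.
have hmi y : jbracket y ^+ k * `|Im (pderives s phi y)| <= m.
  by apply: le_trans (hm y); rewrite ler_wpM2l ?normr_Im_le.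
pose M := row_int (fun y : E => Num.sqrt 2 ^+ k * (c * m) * jweight y).
exists ((M + M) + (M + M)) => x.
apply: (le_trans (ler_wpM2l (w0 _ _) (normc_le_sum _))).
have [-> ->] := cconvE phi s x; rewrite mulrDr; apply: lerD.
  apply: (le_trans (ler_wpM2l (w0 _ _) (ler_normB _ _))); rewrite mulrDr.
  by apply: lerD; [exact: (conv_decay x cur cpr hcr hmr)|exact: (conv_decay x cui cpi hci hmi)].
apply: (le_trans (ler_wpM2l (w0 _ _) (ler_normD _ _))); rewrite mulrDr.
by apply: lerD; [exact: (conv_decay x cur cpi hcr hmi)|exact: (conv_decay x cui cpr hci hmr)].
Qed.
End Mollification.

Section SchwartzMollification.
Context {R : realType} {d : nat}.
Local Notation E := 'rV[R]_d.
Local Notation C := R[i].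
Local Notation S := (schwartz R d).
Local Notation normc := Normc.normc.
Implicit Types (x y z : E) (phi : S) (s : seq 'I_d) (i j : 'I_d).

Lemma smooth0 : smooth (0 : E -> C^o).
Proof. by move=> s x; rewrite pderives0; split; exact: differentiable_cst. Qed.

Lemma smooth_lin (c : C) (g h : E -> C^o) : smooth g -> smooth h -> smooth (c *: g + h).
Proof.
by move=> sg sh s; rewrite pderives_lin//; exact: cdifferentiable_lin.
Qed.

Lemma smooth_sum I (l : seq I) (c : I -> C) (g : I -> E -> C^o) :
  (forall k, smooth (g k)) -> smooth (\sum_(k <- l) c k *: g k).
Proof.
move=> sg; elim: l => [|k l IH]; first by rewrite big_nil; exact: smooth0.
by rewrite big_cons; exact: smooth_lin.
Qed.

Lemma pderives_sum I (l : seq I) (c : I -> C) (g : I -> E -> C^o) s :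
  (forall k, smooth (g k)) ->
  pderives s (\sum_(k <- l) c k *: g k) = \sum_(k <- l) c k *: pderives s (g k).
Proof.
move=> sg; elim: l => [|k l IH]; first by rewrite !big_nil pderives0.
by rewrite !big_cons pderives_lin ?IH//; exact: smooth_sum.
Qed.

Lemma weighted_sum_bound I (l : seq I) (c : I -> C) (g : I -> E -> C^o) (n : nat) :
  (forall k, exists M : R, forall x, jbracket x ^+ n * normc (g k x) <= M) ->
  exists M : R, forall x, jbracket x ^+ n * normc ((\sum_(k <- l) c k *: g k) x) <= M.
Proof.
move=> bg; elim: l => [|k l [M hM]].
  by exists 0 => x; rewrite big_nil Normc.normc0 mulr0.
have [N hN] := bg k; exists (normc (c k) * N + M) => x; rewrite big_cons !fctE.
have w0 : 0 <= jbracket x ^+ n by rewrite exprn_ge0 ?jbracket_ge0.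
apply: (le_trans (ler_wpM2l w0 (le_normcD _ _))).
rewrite mulrDr lerD ?hM// Normc.normcM mulrCA ler_wpM2l ?normc_ge0//.
Qed.

Definition schwartz_pderives s phi : S := foldr schwartz_pderive phi s.

Lemma val_schwartz_pderives s phi :
  (schwartz_pderives s phi : E -> C^o) = pderives s phi.
Proof. by elim: s => //= i s IH; rewrite -IH. Qed.

(** Each transposition gives a sign, and moving the derivatives onto the test function reverses
    their order. *)
Lemma dpderivesE (T : S -> C^o) s phi :
  dpderives s T phi = (-1) ^+ size s * T (schwartz_pderives (rev s) phi).
Proof.
elim: s phi => [|i s IH] phi; first by rewrite mul1r.
rewrite /= /dpderive IH rev_cons exprS -mulrA mulN1r; congr (- (_ * T _)).
by rewrite /schwartz_pderives foldr_rcons.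
Qed.

(** For each [k], writing [f] with densities of decay [k + 2 * d] displays the function as a finite
    sum of convolutions whose derivatives all decay to order [k]. The representation changes with
    [k], but the function does not; smoothness is read off at [k = 0]. *)
Lemma mollify_in_schwartz (f : S -> C^o) phi : rapidly_decreasing f ->
  (fun x => f (schwartz_translate x phi)) \in schwartz_fun.
Proof.
move=> [_ rf].
have rep k : exists n (c : 'I_n -> C) (g : 'I_n -> E -> C^o),
    [/\ forall l, smooth (g l),
     (fun x => f (schwartz_translate x phi)) = \sum_l c l *: g l &
     forall s l, exists M : R, forall x, jbracket x ^+ k * normc (pderives s (g l) x) <= M].
  have [n [beta [u [hu fE]]]] := rf (k + 2 * d)%N.
  exists n, (fun l => (-1) ^+ size (beta l)),
    (fun l => cconv (u l) (pderives (rev (beta l)) phi)).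
  have hu1 l := proj1 (hu l); have hu2 l := proj2 (hu l).
  split.
  - by move=> l; exact: smooth_cconv (hu1 l) (hu2 l) _ _.
  - apply/funext => x; rewrite fE !fct_sumE; apply: eq_bigr => l _.
    rewrite dpderivesE; congr (_ * _); rewrite /regular_dist /cconv.
    by rewrite val_schwartz_pderives pderives_translate.
  - by move=> s l; rewrite (pderives_cconv (hu1 l) (hu2 l)); exact: cconv_decay.
apply/schwartz_funP; split.
  have [n [c [g [sg -> _]]]] := rep 0%N; exact: smooth_sum.
move=> k s; have [n [c [g [sg -> bg]]]] := rep k.
have [M hM] := weighted_sum_bound (index_enum _) c (bg s).
exists M => _ [x _ <-]; rewrite pderives_sum//; exact: hM.
Qed.

Definition mollify (f : S -> C^o) (rf : rapidly_decreasing f) phi : S :=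
  Sub (fun x => f (schwartz_translate x phi)) (mollify_in_schwartz phi rf).

Lemma mollifyE f (rf : rapidly_decreasing f) phi x :
  mollify rf phi x = f (schwartz_translate x phi).
Proof. by []. Qed.

Lemma convolutionE f (rf : rapidly_decreasing f) (g : S -> C^o) phi :
  convolution f g phi = g (mollify rf phi).
Proof.
rewrite /convolution; congr g; apply: val_inj; rewrite /= insubdK//.
exact: mollify_in_schwartz.
Qed.

Lemma schwartz_translate_add x y phi :
  schwartz_translate x (schwartz_translate y phi) = schwartz_translate (x + y) phi.
Proof.
apply: val_inj; apply/funext => z.
by rewrite /= /translate_fun addrCA addrA.
Qed.

Lemma mollify_translate f (rf : rapidly_decreasing f) phi x y :
  mollify rf (schwartz_translate y phi) x = mollify rf phi (x + y).
Proof. by rewrite !mollifyE schwartz_translate_add. Qed.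
End SchwartzMollification.

(** * Smooth partitions of unity *)

Section Flat.
Context {R : realType}.
Implicit Types (t x : R) (n : nat).

(** The function t^(-n) exp(-1/t) extended by 0. The powers are included so that the family is
    closed under differentiation, up to linear combinations. *)
Definition flat n t : R := if 0 < t then t^-1 ^+ n * expR (- t^-1) else 0.

Lemma flat_ge0 n t : 0 <= flat n t.
Proof.
rewrite /flat; case: ifPn => // t0.
by rewrite mulr_ge0 ?expR_ge0// exprn_ge0// invr_ge0 ltW.
Qed.

(** Raise x/(n+1) <= exp(x/(n+1)) to the power n and use nx/(n+1) <= x. Dividing by n+1 instead of n
    covers n = 0. *)
Lemma exprn_expRN_le n x : 0 <= x -> x ^+ n * expR (- x) <= n.+1%:R ^+ n.
Proof.
move=> x0; rewrite expRN ler_pdivrMr ?expR_gt0//.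
have y0 : 0 <= x / n.+1%:R by rewrite divr_ge0.
have h : x ^+ n <= (n.+1%:R * expR (x / n.+1%:R)) ^+ n.
  rewrite lerXn2r ?nnegrE ?mulr_ge0 ?expR_ge0//.
  rewrite -[X in X <= _](divfK (_ : n.+1%:R != 0)) ?pnatr_eq0// mulrC ler_wpM2l//.
  by apply: le_trans (expR_ge1Dx _); rewrite lerDr.
apply: (le_trans h); rewrite exprMn ler_wpM2l ?exprn_ge0// -expRM_natl ler_expR.
rewrite -[leRHS](divfK (_ : n.+1%:R != 0)) ?pnatr_eq0// mulrC ler_wpM2l//.
by rewrite ler_nat.
Qed.

Lemma flat_le n t : flat n t <= n.+1%:R ^+ n.
Proof.
rewrite /flat; case: ifPn => t0; last by rewrite exprn_ge0.
by apply: exprn_expRN_le; rewrite invr_ge0 ltW.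
Qed.

(** Together with the bound on [flat n.+2] this gives flat n t = O(t^2), hence derivative 0 at the
    origin. *)
Lemma flatS2 n t : flat n t = t ^+ 2 * flat n.+2 t.
Proof.
rewrite /flat; case: ifPn => t0; last by rewrite mulr0.
by rewrite !exprS expr0; field; rewrite gt_eqF.
Qed.

Lemma is_derive_flat n t : is_derive t (1 : R) (flat n)
  (flat n.+2 t - n%:R * flat n.+1 t).
Proof.
have [t0|t0|t0] := ltgtP t 0.
- rewrite (_ : _ - _ = 0); last first.
    by rewrite /flat ltNge (ltW t0) /= mulr0 subr0.
  have e : {near t, cst 0 =1 flat n}.
    near=> s; rewrite /flat /cst /= ltNge ltW//.
    by near: s; exact: lt_nbhsl.
  exact: (near_eq_is_derive e (is_derive_cst _ _ _)).
- pose g s : R := s^-1 ^+ n * expR (- s^-1).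
  have e : {near t, g =1 flat n}.
    near=> s; rewrite /g /flat ifT//.
    by near: s; exact: lt_nbhsr.
  have tn0 : t != 0 by rewrite gt_eqF.
  apply: (near_eq_is_derive e).
  have di : is_derive t (1 : R) (fun s : R => s^-1) (- t ^- 2).
    have h := @is_derive_id R R t 1.
    apply: DeriveDef; first exact: derivableV.
    by rewrite deriveV// derive_id /GRing.scale /= mulr1.
  rewrite (_ : g = (fun s : R => s^-1) ^+ n * (expR \o (- (fun s : R => s^-1)))); last first.
    by apply/funext => s; rewrite /g fctE /= fctE.
  apply: is_derive_eq; rewrite /GRing.scale /= /flat t0 !fctE.
  case: n {e} @g => [|m] g; first by rewrite !expr0 !mul0r; field.
  by rewrite /= !exprS; field.
rewrite t0 /flat ltxx mulr0 subr0 -/(flat n).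
have lim0 : (fun h : R => h^-1 *: ((flat n \o shift 0) (h *: (1 : R)) - flat n 0))
    @ 0^' --> (0 : R).
  apply/cvgrPdist_le => e e0; near=> h.
  rewrite /= addr0 [h *: 1]mulr1 {2}/flat ltxx subr0 sub0r normrN flatS2.
  have h0 : h != 0 by near: h; exact: nbhs_dnbhs_neq.
  rewrite /GRing.scale /= expr2 -!mulrA mulKf// normrM (ger0_norm (flat_ge0 _ _)).
  apply: (@le_trans _ _ (`|h| * n.+3%:R ^+ n.+2)); first by rewrite ler_wpM2l// flat_le.
  rewrite -ler_pdivlMr ?exprn_gt0//.
  near: h; apply: cvg_within; apply/nbhs_ballP; exists (e / n.+3%:R ^+ n.+2) => /=.
    by rewrite divr_gt0// exprn_gt0.
  by move=> y; rewrite -ball_normE /ball_ /= sub0r normrN => /ltW.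
apply: DeriveDef; last exact: cvg_lim lim0.
by apply/cvg_ex; exists 0.
Unshelve. all: by end_near. Qed.

Lemma flat0_ge t : 2^-1 <= t -> expR (- 2) <= flat 0 t.
Proof.
move=> th; have t0 : 0 < t by apply: lt_le_trans th; rewrite invr_gt0.
rewrite /flat t0 expr0 mul1r ler_expR lerN2 -[leRHS]invrK lef_pV2 ?posrE ?invr_gt0//.
Qed.

(** One of t and 1 - t is at least 1/2. The positive lower bound is what allows [step] to be built
    with [SFinv]. *)
Lemma flat0D_ge t : expR (- 2) <= flat 0 t + flat 0 (1 - t).
Proof.
have [h|h] := leP 2^-1 t; first by rewrite -[leLHS]addr0 lerD ?flat0_ge ?flat_ge0.
by rewrite -[leLHS]add0r lerD ?flat0_ge ?flat_ge0//; lra.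
Qed.

Definition step t : R := flat 0 t / (flat 0 t + flat 0 (1 - t)).

Lemma step_le0 t : t <= 0 -> step t = 0.
Proof. by move=> t0; rewrite /step {1}/flat ltNge t0 /= mul0r. Qed.

Lemma step_ge1 t : 1 <= t -> step t = 1.
Proof.
move=> t1; rewrite /step {3}/flat ltNge subr_le0 t1 /= addr0 divff//.
have := flat0D_ge t; rewrite {2}/flat ltNge subr_le0 t1 /= addr0 => h.
by rewrite gt_eqF// (lt_le_trans _ h)// expR_gt0.
Qed.
End Flat.

Section SmoothFamilies.
Context {R : realType} {d : nat}.
Local Notation E := 'rV[R]_d.
Local Notation e_ i := (delta_mx 0 i : E).
Implicit Types (x y : E) (g h : nat -> E -> R) (i j : 'I_d).

(* Sequences of functions whose partial derivatives of each order are bounded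
   uniformly along the sequence; the shifts [b N] are arbitrary. *)
Inductive smooth_family : (nat -> E -> R) -> Prop :=
| SFcst c : smooth_family (fun _ _ => c)
| SFflat n a i (b : nat -> R) : smooth_family (fun N x => flat n (a * x 0 i + b N))
| SFadd g h : smooth_family g -> smooth_family h ->
    smooth_family (fun N x => g N x + h N x)
| SFmul g h : smooth_family g -> smooth_family h ->
    smooth_family (fun N x => g N x * h N x)
| SFinv g c : smooth_family g -> 0 < c -> (forall N x, c <= g N x) ->
    smooth_family (fun N x => (g N x)^-1).

Lemma smooth_family_bounded g : smooth_family g ->
  exists M : R, forall N x, `|g N x| <= M.
Proof.
elim=> [c|n a i b|{}g h _ [M hM] _ [M' hM']|{}g h _ [M hM] _ [M' hM']|{}g c _ _ c0 gc].
- by exists `|c|.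
- by exists (n.+1%:R ^+ n) => N x; rewrite ger0_norm ?flat_ge0// flat_le.
- by exists (M + M') => N x; rewrite (le_trans (ler_normD _ _))// lerD.
- by exists (M * M') => N x; rewrite normrM ler_pM.
- exists c^-1 => N x; have g0 := lt_le_trans c0 (gc N x).
  by rewrite normfV gtr0_norm// lef_pV2.
Qed.

Lemma differentiable_affine_coord (a b : R) i x :
  differentiable (fun x : E => a * x 0 i + b) x /\
  forall j, 'D_(e_ j) (fun x : E => a * x 0 i + b) x = a * (i == j)%:R.
Proof.
apply: (@quadratic_differentiable _ _ _ _ (fun j => a * (i == j)%:R) 0) => h.
rewrite mul0r (bigD1 i)//= big1 ?eqxx ?addr0; last first.
  by move=> j ji; rewrite eq_sym (negbTE ji) !mulr0.
rewrite mxE mulr1 normr_le0; apply/eqP.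
by ring.
Qed.

(** The derivative is again an expression of the same kind, with the same constants for all [N];
    iterating, all orders are bounded uniformly in [N]. *)
Lemma smooth_family_derive g i : smooth_family g ->
  exists2 g', smooth_family g' & forall N x,
    differentiable (g N) x /\ 'D_(e_ i) (g N) x = g' N x.
Proof.
elim=> [c|n a j b|{}g h sg [g' sg' dg] sh [h' sh' dh]
  |{}g h sg [g' sg' dg] sh [h' sh' dh]|{}g c sg [g' sg' dg] c0 gc].
- exists (fun _ _ => 0); first exact: SFcst.
  by move=> N x; split; [exact: differentiable_cst|exact: derive_cst].
- exists (fun N x => (a * (j == i)%:R) *
    (flat n.+2 (a * x 0 j + b N) + (- n%:R) * flat n.+1 (a * x 0 j + b N))).
    apply: SFmul; first exact: SFcst.
    apply: SFadd; first exact: SFflat.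
    by apply: SFmul; [exact: SFcst|exact: SFflat].
  move=> N x; have [dl Dl] := differentiable_affine_coord a (b N) j x.
  have fl := is_derive_flat n (a * x 0 j + b N).
  have df : differentiable (flat n) (a * x 0 j + b N).
    by apply/derivable1_diffP; have [] := fl.
  have dc : differentiable (flat n \o (fun x : E => a * x 0 j + b N)) x.
    exact: differentiable_comp.
  split=> //; rewrite (deriveE _ dc) diff_comp//= -(deriveE _ dl) Dl.
  rewrite deriv1E; last by have [] := fl.
  by rewrite derive1E derive_val mulNr.
- exists (fun N x => g' N x + h' N x); first exact: SFadd.
  move=> N x; have [dgN Dg] := dg N x; have [dhN Dh] := dh N x.
  split; first exact: (differentiableD dgN dhN).
  by rewrite (deriveD (diff_derivable dgN) (diff_derivable dhN)) Dg Dh.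
- exists (fun N x => g N x * h' N x + h N x * g' N x).
    by apply: SFadd; apply: SFmul.
  move=> N x; have [dgN Dg] := dg N x; have [dhN Dh] := dh N x.
  split; first exact: (differentiableM dgN dhN).
  by rewrite (deriveM (diff_derivable dgN) (diff_derivable dhN)) Dg Dh.
- exists (fun N x => (-1) * ((g N x)^-1 * (g N x)^-1) * g' N x).
    apply: SFmul => //; apply: SFmul; first exact: SFcst.
    by apply: SFmul; exact: SFinv c0 gc.
  move=> N x; have [dgN Dg] := dg N x.
  have gn0 : g N x != 0 by rewrite gt_eqF// (lt_le_trans c0).
  split; first exact: (differentiableV dgN gn0).
  rewrite (deriveV gn0 (diff_derivable dgN)) Dg /GRing.scale /= -exprVn expr2; ring.
Qed.

Lemma smooth_family_prod I (l : seq I) (G : I -> nat -> E -> R) :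
  (forall k, smooth_family (G k)) ->
  smooth_family (fun N x => \prod_(k <- l) G k N x).
Proof.
move=> sG; elim: l => [|k l IH].
  rewrite (_ : (fun _ => _) = (fun _ _ => 1)); first exact: SFcst.
  by apply/funext => N; apply/funext => x; rewrite big_nil.
rewrite (_ : (fun _ => _) = (fun N x => G k N x * \prod_(k <- l) G k N x)).
  exact: SFmul.
by apply/funext => N; apply/funext => x; rewrite big_cons.
Qed.

Lemma smooth_family_step (a : R) i (b : nat -> R) :
  smooth_family (fun N x => step (a * x 0 i + b N)).
Proof.
have s1 : smooth_family (fun N x => flat 0 (a * x 0 i + b N)) by exact: SFflat.
have s2 : smooth_family (fun N x => flat 0 (1 - (a * x 0 i + b N))).
  rewrite (_ : (fun _ => _) = (fun N x => flat 0 ((- a) * x 0 i + (1 - b N)))).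
    exact: (SFflat 0 (- a) i (fun N => 1 - b N)).
  by apply/funext => N; apply/funext => x; congr flat; ring.
apply: SFmul => //; apply: (SFinv (SFadd s1 s2) (expR_gt0 (- 2))) => N x.
exact: flat0D_ge.
Qed.

Lemma smooth_family_sub g h : smooth_family g -> smooth_family h ->
  smooth_family (fun N x => g N x - h N x).
Proof.
move=> sg sh; rewrite (_ : (fun _ => _) = (fun N x => g N x + (-1) * h N x)).
  by apply: SFadd => //; apply: SFmul => //; exact: SFcst.
by apply/funext => N; apply/funext => x; rewrite mulN1r.
Qed.
End SmoothFamilies.

(** * Multiplication of Schwartz functions by smooth families, and decay of tails *)

Section Cutoff.
Context {R : realType} {d : nat}.
Local Notation E := 'rV[R]_d.
Local Notation C := R[i].
Local Notation S := (schwartz R d).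
Local Notation Re := complex.Re.
Local Notation Im := complex.Im.
Local Notation normc := Normc.normc.
Local Notation e_ i := (delta_mx 0 i : E).
Implicit Types (x y z : E) (phi : S) (s : seq 'I_d) (i j : 'I_d) (psi : E -> C^o).
Implicit Types (g : nat -> E -> R) (F : nat -> E -> C^o).

Definition rmul (a : E -> R) psi : E -> C^o :=
  fun x => (a x * Re (psi x) +i* (a x * Im (psi x)))%C.

Lemma normc_rmul (a : E -> R) psi x : normc (rmul a psi x) = `|a x| * normc (psi x).
Proof.
rewrite /rmul; case: (psi x) => p q /=.
by rewrite !exprMn -mulrDr sqrtrM ?sqr_ge0// sqrtr_sqr.
Qed.

Lemma cdifferentiable_rmul (a : E -> R) psi : (forall x, differentiable a x) ->
  cdifferentiable psi -> cdifferentiable (rmul a psi).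
Proof.
move=> da dp x; have [dr di] := dp x.
by split; [exact: (differentiableM (da x) dr)|exact: (differentiableM (da x) di)].
Qed.

Lemma pderive_rmul (a a' : E -> R) psi i :
  (forall x, differentiable a x /\ 'D_(e_ i) a x = a' x) -> cdifferentiable psi ->
  pderive i (rmul a psi) = rmul a' psi + rmul a (pderive i psi).
Proof.
move=> da dp; apply/funext => x; have [dax Dax] := da x; have [dr di] := dp x.
have D (f : E -> R) : differentiable f x ->
    'D_(e_ i) (fun y => a y * f y) x = a' x * f x + a x * 'D_(e_ i) f x.
  move=> df; rewrite (deriveM (f := a) (diff_derivable dax) (diff_derivable df)) Dax.
  by rewrite addrC /GRing.scale /= (mulrC (f x)).
apply/eqP; rewrite eq_complex; apply/andP; split; apply/eqP; exact: D.
Qed.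

(* The families obtained from [g_N phi] by the Leibniz rule. *)
Inductive leibniz_family phi : (nat -> E -> C^o) -> Prop :=
| LFmul g s : smooth_family g ->
    leibniz_family phi (fun N => rmul (g N) (pderives s phi))
| LFadd F G : leibniz_family phi F -> leibniz_family phi G ->
    leibniz_family phi (fun N => F N + G N).

Lemma smooth_family_differentiable g : smooth_family g ->
  forall N x, differentiable (g N) x.
Proof.
case: (pickP (fun _ : 'I_d => true)) => [i _|h] sg N x.
  by have [g' _ /(_ N x)[]] := smooth_family_derive i sg.
(* There is no direction, so [d = 0] and the space is a single point. *)
rewrite (_ : g N = cst (g N x)); first exact: differentiable_cst.
by apply/funext => y; congr (g N); apply/rowP => i; have := h i.
Qed.

Lemma leibniz_family_cdifferentiable phi F : leibniz_family phi F ->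
  forall N, cdifferentiable (F N).
Proof.
elim=> [g s sg|{}F G _ dF _ dG] N.
  apply: cdifferentiable_rmul; last exact: schwartz_smooth.
  exact: smooth_family_differentiable.
by rewrite -[F N]scale1r; apply: cdifferentiable_lin.
Qed.

Lemma leibniz_family_pderive phi F i : leibniz_family phi F ->
  leibniz_family phi (fun N => pderive i (F N)).
Proof.
elim=> [g s sg|{}F G lF IF lG IG].
  have [g' sg' dg] := smooth_family_derive i sg.
  rewrite (_ : (fun _ => _) = (fun N => rmul (g' N) (pderives s phi) +
     rmul (g N) (pderives (i :: s) phi))).
    by apply: LFadd; exact: LFmul.
  by apply/funext => N; apply: pderive_rmul => //; exact: schwartz_smooth.
rewrite (_ : (fun _ => _) = (fun N => pderive i (F N) + pderive i (G N))).
  exact: LFadd.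
apply/funext => N; have dF := leibniz_family_cdifferentiable lF N.
have dG := leibniz_family_cdifferentiable lG N.
by rewrite -[F N]scale1r pderive_lin// !scale1r.
Qed.

Lemma leibniz_family_pderives phi F s : leibniz_family phi F ->
  leibniz_family phi (fun N => pderives s (F N)).
Proof. by move=> lF; elim: s => //= i s IH; exact: leibniz_family_pderive. Qed.

Lemma leibniz_family_bound phi F k : leibniz_family phi F ->
  exists M : R, forall N x, jbracket x ^+ k * normc (F N x) <= M.
Proof.
have w0 x : 0 <= jbracket x ^+ k :> R by rewrite exprn_ge0 ?jbracket_ge0.
elim=> [g s sg|{}F G _ [M hM] _ [M' hM']].
  have [M hM] := smooth_family_bounded sg; have [M' hM'] := schwartz_bound phi k s.
  exists (M * M') => N x; rewrite normc_rmul mulrCA.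
  by apply: ler_pM => //; rewrite mulr_ge0 ?normc_ge0.
exists (M + M') => N x; apply: (le_trans (ler_wpM2l (w0 x) (le_normcD _ _))).
by rewrite mulrDr lerD.
Qed.

Lemma leibniz_family_rmul g phi : smooth_family g ->
  leibniz_family phi (fun N => rmul (g N) phi).
Proof. exact: (@LFmul _ _ [::]). Qed.

Lemma rmul_in_schwartz g (sg : smooth_family g) N phi :
  rmul (g N) phi \in schwartz_fun.
Proof.
apply/schwartz_funP; split=> [s|k s].
  have lf := leibniz_family_pderives s (leibniz_family_rmul phi sg).
  exact: leibniz_family_cdifferentiable lf N.
have [M hM] := leibniz_family_bound k
  (leibniz_family_pderives s (leibniz_family_rmul phi sg)).
by exists M => _ [x _ <-]; exact: hM.
Qed.

Definition schwartz_rmul g (sg : smooth_family g) N phi : S :=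
  Sub (rmul (g N) phi) (rmul_in_schwartz sg N phi).

Lemma pderives_eq0 (U : set E) psi s : open U -> (forall x, U x -> psi x = 0) ->
  forall x, U x -> pderives s psi x = 0.
Proof.
move=> oU p0; elim: s => //= i s IH x Ux.
have nU : \forall y \near x, U y by exact: open_nbhs_nbhs.
apply/eqP; rewrite eq_complex; apply/andP; split; apply/eqP => /=.
  rewrite (near_eq_derive (g := cst 0)) ?derive_cst//.
  by apply: filterS nU => y Uy; rewrite IH.
rewrite (near_eq_derive (g := cst 0)) ?derive_cst//.
by apply: filterS nU => y Uy; rewrite IH.
Qed.

Lemma norm_le_jbracket x : `|x| <= jbracket x.
Proof.
rewrite -(ler_pXn2r (n := 2))// ?nnegrE ?jbracket_ge0// jbracket_sqn.
have [/eqP ->|x0] := boolP (`|x| == 0).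
  by rewrite expr0n addr_ge0 ?sqn_ge0.
have xp : 0 < `|x| by rewrite lt_neqAle eq_sym x0 /=.
by apply: (le_trans (sqn_ge_norm xp (lexx _))); rewrite lerDr.
Qed.

(** Where the product and its derivatives can be nonzero, e N <= |x| <= [jbracket x], so one extra
    power of the weight, bounded uniformly in [N], pays for the factor [N]. *)
Lemma seminorm_tail g (sg : smooth_family g) phi (e : R) k s : 0 < e ->
  (forall N x, `|x| < e * N%:R -> g N x = 0) ->
  exists M : R, forall N, N%:R * seminorm k s (schwartz_rmul sg N phi) <= M.
Proof.
move=> e0 g0.
have [M hM] := leibniz_family_bound k.+1
  (leibniz_family_pderives s (leibniz_family_rmul phi sg)).
have M0 : 0 <= M.
  by apply: le_trans (hM 0%N 0); rewrite mulr_ge0 ?exprn_ge0 ?jbracket_ge0 ?normc_ge0.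
exists (M / e) => N; case: N => [|N]; first by rewrite mul0r divr_ge0// ltW.
have N0 : 0 < N.+1%:R :> R by [].
rewrite mulrC -ler_pdivlMr//; apply: ge_sup.
  by eexists; exists (0 : E).
move=> _ [x _ <-].
have [xN|xN] := ltP `|x| (e * N.+1%:R).
  rewrite (@pderives_eq0 (ball 0 (e * N.+1%:R))) ?Normc.normc0 ?mulr0.
  - by rewrite !divr_ge0// ltW.
  - exact: ball_open.
  - move=> y; rewrite -ball_normE /ball_ /= sub0r normrN => yN.
    by rewrite /schwartz_val /= /rmul g0// !mul0r.
  - by rewrite -ball_normE /ball_ /= sub0r normrN.
rewrite ler_pdivlMr// ler_pdivlMr// -mulrA (mulrC N.+1%:R).
apply: le_trans (hM N.+1 x).
rewrite exprSr [leRHS]mulrAC; apply: ler_wpM2l.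
  by rewrite mulr_ge0 ?exprn_ge0 ?jbracket_ge0 ?normc_ge0.
exact: le_trans (norm_le_jbracket x).
Qed.

(** Continuity of [f] involves finitely many seminorms, so O(1/N) in each of them passes to the
    values of [f]. *)
Lemma tempered_scaled_limit0 (f : S -> C^o) (F : nat -> S) : tempered f ->
  (forall k s, exists M : R, forall N, N%:R * seminorm k s (F N) <= M) ->
  exists M : R, forall N, N%:R * normc (f (F N)) <= M.
Proof.
move=> [_ [k [c fc]]] hF.
have /choice[M hM] : forall ns : 'I_k.+1, exists M : R, forall (s : ns.-tuple 'I_d) N,
    N%:R * seminorm k s (F N) <= M.
  move=> n; have [M hM] := @bounds_finType R _ _
    (fun (s : n.-tuple 'I_d) N => N%:R * seminorm k s (F N)) (fun t => hF k t).
  by exists M.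
have sn0 s N : 0 <= seminorm k s (F N).
  have /schwartz_funP[_ /(_ k s) ub] := valP (F N).
  apply: le_trans (ub_le_sup ub _); last by exists (0 : E).
  by rewrite mulr_ge0 ?exprn_ge0 ?jbracket_ge0 ?normc_ge0.
exists (`|c| * \sum_(n < k.+1) \sum_(s : n.-tuple 'I_d) M n) => N.
apply: (le_trans (ler_wpM2l (ler0n _ _) (fc (F N)))).
rewrite mulrCA; apply: (@le_trans _ _
    (`|c| * (N%:R * \sum_(n < k.+1) \sum_(s : n.-tuple 'I_d) seminorm k s (F N)))).
  rewrite ler_wpM2r ?ler_norm// mulr_ge0// sumr_ge0// => n _.
  by rewrite sumr_ge0.
rewrite ler_wpM2l// mulr_sumr; apply: ler_sum => n _.
by rewrite mulr_sumr; apply: ler_sum => s _; exact: hM.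
Qed.
End Cutoff.

Section Partition.
Context {R : realType} {d : nat}.
Local Notation E := 'rV[R]_d.
Local Notation C := R[i].
Local Notation S := (schwartz R d).
Local Notation normc := Normc.normc.
Implicit Types (x y z c : E) (phi : S) (i j : 'I_d).

Definition bump (t : R) : R := step (t + 1) - step t.

Lemma bump_eq0 t : 1 <= `|t| -> bump t = 0.
Proof.
rewrite /bump; have [t0|t0] := leP 0 t => t1.
  by rewrite ger0_norm// in t1; rewrite !step_ge1 ?subrr//; lra.
by rewrite ltr0_norm// in t1; rewrite !step_le0 ?subrr//; lra.
Qed.

(** Each bump is a difference of two consecutive integer shifts of [step], so the sum telescopes. *)
Lemma bump_sum (N : nat) t :
  \sum_(m < N.*2.+1) bump (t + (N%:R - m%:R)) = step (t + (N%:R + 1)) - step (t - N%:R).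
Proof.
pose u (m : nat) := - step (t + (N%:R - m%:R + 1)).
rewrite (eq_bigr (fun m : 'I__ => u m.+1 - u m)); last first.
  move=> m _; rewrite /bump /u opprK [RHS]addrC; congr (step _ - step _); first by ring.
  by rewrite -natr1; ring.
rewrite -(big_mkord xpredT (fun m => u m.+1 - u m)) telescope_sumr// /u opprK addrC.
congr (step _ - step _); first by rewrite subr0.
by rewrite -natr1 -muln2 natrM; ring.
Qed.

(** The bump of width [e] at the grid point with coordinates e (k_i - N). The ignored first argument
    makes a single function a constant [smooth_family]. *)
Definition cell (e : R) (N : nat) (k : {ffun 'I_d -> 'I_N.*2.+1}) : nat -> E -> R :=
  fun _ x => \prod_i bump (e^-1 * x 0 i + (N%:R - (k i)%:R)).

(** The sum of all cells of level [N], in telescoped form: [N] enters only through shifts, so the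
    derivatives are bounded uniformly in [N], which is not visible on a sum with a growing number of
    terms. *)
Definition cutoff (e : R) : nat -> E -> R :=
  fun N x => \prod_i (step (e^-1 * x 0 i + (N%:R + 1)) - step (e^-1 * x 0 i + - N%:R)).

Lemma smooth_family_cell e N (k : {ffun 'I_d -> 'I_N.*2.+1}) : smooth_family (cell e k).
Proof.
apply: smooth_family_prod => i; apply: smooth_family_sub.
  rewrite (_ : (fun _ => _) = (fun _ x => step (e^-1 * x 0 i + (N%:R - (k i)%:R + 1)))).
    exact: (smooth_family_step e^-1 i (fun=> N%:R - (k i)%:R + 1)).
  by apply/funext => M; apply/funext => x; congr step; ring.
exact: (smooth_family_step e^-1 i (fun=> N%:R - (k i)%:R)).
Qed.

Lemma smooth_family_tail e : smooth_family (fun N x => 1 - cutoff e N x).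
Proof.
apply: smooth_family_sub; first exact: SFcst.
apply: smooth_family_prod => i; apply: smooth_family_sub.
  exact: (smooth_family_step e^-1 i (fun N => N%:R + 1)).
exact: (smooth_family_step e^-1 i (fun N => - N%:R)).
Qed.

Lemma cutoffE e N x : 
  cutoff e N x = \sum_(k : {ffun 'I_d -> 'I_N.*2.+1}) cell e k 0 x.
Proof.
transitivity (\prod_i \sum_(m < N.*2.+1) bump (e^-1 * x 0 i + (N%:R - m%:R))).
  by apply: eq_bigr => i _; rewrite bump_sum.
exact: bigA_distr_bigA.
Qed.

Lemma cutoff_eq1 e N x : 0 < e -> `|x| < e * N%:R -> cutoff e N x = 1.
Proof.
move=> e0 xN; rewrite /cutoff big1// => i _.
have : `|e^-1 * x 0 i| < N%:R.
  rewrite normrM gtr0_norm ?invr_gt0// mulrC ltr_pdivrMr// mulrC.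
  exact: le_lt_trans (normr_coord_le x i) xN.
rewrite ltr_norml => /andP[h1 h2].
by rewrite step_ge1 ?step_le0 ?subr0//; lra.
Qed.

Lemma cell_support e N (k : {ffun 'I_d -> 'I_N.*2.+1}) M x : 0 < e -> cell e k M x != 0 ->
  `|x - \row_i (e * ((k i)%:R - N%:R))| < e.
Proof.
move=> e0 h; apply/normr_row_lt => // i; rewrite !mxE.
have : `|e^-1 * x 0 i + (N%:R - (k i)%:R)| < 1.
  rewrite ltNge; apply: contra h => /bump_eq0 b0.
  by rewrite /cell (bigD1 i)//= b0 mul0r.
rewrite (_ : _ + _ = e^-1 * (x 0 i - e * ((k i)%:R - N%:R))); last first.
  by field; rewrite gt_eqF.
by rewrite normrM gtr0_norm ?invr_gt0// mulrC ltr_pdivrMr// mul1r.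
Qed.

Lemma schwartz_sumE I (l : seq I) (p : I -> S) x :
  (\sum_(k <- l) p k : S) x = \sum_(k <- l) p k x.
Proof. by elim: l => [|k l IH]; rewrite ?big_nil ?big_cons// -IH. Qed.

Lemma schwartz_cutoff e N phi :
  phi = schwartz_rmul (smooth_family_tail e) N phi +
    \sum_k schwartz_rmul (smooth_family_cell e (N := N) k) 0 phi.
Proof.
apply/val_inj/funext => x.
transitivity (schwartz_rmul (smooth_family_tail e) N phi x +
    (\sum_k schwartz_rmul (smooth_family_cell e (N := N) k) 0 phi : S) x); last by [].
rewrite schwartz_sumE.
transitivity (schwartz_rmul (smooth_family_tail e) N phi x +
    rmul (cutoff e N) phi x).
  change (phi x = rmul (fun x => 1 - cutoff e N x) phi x + rmul (cutoff e N) phi x).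
  rewrite /rmul; case: (phi x) => p q.
  by apply/eqP; rewrite eq_complex /=; apply/andP; split; apply/eqP; ring.
congr (_ + _); apply/eqP; rewrite eq_complex !raddf_sum /=.
by rewrite cutoffE !mulr_suml !eqxx.
Qed.

(** Each cell times [phi] has small support and is killed by [f], so [f phi] equals the value of [f]
    on the tail for every [N]. That value is O(1/N), hence 0. *)
Lemma tempered_local_eq0 (f : S -> C^o) (e : R) : tempered f -> 0 < e ->
  (forall phi c, (forall x, phi x != 0 -> `|x - c| <= e) -> f phi = 0) -> f = 0.
Proof.
move=> tf e0 loc; apply/funext => phi.
have [lf _] := tf.
pose L : {linear S -> C^o} := HB.pack f (GRing.isLinear.Build _ _ _ _ f lf).
have tailE N : f phi = f (schwartz_rmul (smooth_family_tail e) N phi).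
  rewrite {1}(schwartz_cutoff e N phi) -[LHS]/(L _) raddfD raddf_sum big1 ?addr0//= => k _.
  apply: (loc _ (\row_i (e * ((k i)%:R - N%:R)))) => x.
  have [c0|/(cell_support e0)/ltW//] := eqVneq (cell e k 0 x) 0.
  by rewrite /schwartz_val /= /rmul c0 !mul0r eqxx.
have [M hM] : exists M : R, forall N, N%:R * normc (f phi) <= M.
  have [M hM] := tempered_scaled_limit0 tf (fun k s =>
    seminorm_tail (smooth_family_tail e) phi k s e0 (fun N x h =>
      etrans (congr1 (fun t => 1 - t) (cutoff_eq1 e0 h)) (subrr 1))).
  by exists M => N; rewrite (tailE N).
apply: Normc.eq0_normc; apply/eqP; rewrite eq_le normc_ge0 andbT leNgt; apply/negP => p0.
have := hM (Num.bound (M / normc (f phi))); rewrite leNgt => /negP; apply.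
have M0 : 0 <= M by have := hM 0%N; rewrite mul0r.
rewrite -ltr_pdivrMr//; apply: archi_boundP.
by rewrite divr_ge0// normc_ge0.
Qed.
End Partition.

(** * Unique continuation *)

Section UniqueContinuation.
Context {R : realType} {d : nat}.
Local Notation E := 'rV[R]_d.
Local Notation C := R[i].
Local Notation S := (schwartz R d).
Local Notation Re := complex.Re.
Local Notation Im := complex.Im.
Implicit Types (x y z c : E) (phi : S) (i j : 'I_d).

(** The gap between [e] and [r] keeps the topological support, which lies in the closed ball of
    radius [e], inside [V]; Heine-Borel makes it compact. *)
Lemma vanishes_on_ball (V : set E) (T : S -> C^o) c (e r : R) phi :
  vanishes_on V T -> 0 < e -> e < r -> ball c r `<=` V ->
  (forall y, phi y != 0 -> `|y - c| <= e) -> T phi = 0.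
Proof.
move=> vT e0 er cV hphi.
have cb : closed (closed_ball c e) by exact: closed_ball_closed.
have sub : tsupport phi `<=` closed_ball c e.
  have /closure_id -> := cb; apply: closure_subset => y /= /hphi h.
  by rewrite closed_ballE// /closed_ball_ /= distrC.
apply: vT; last first.
  move=> y /sub; rewrite closed_ballE// /closed_ball_ /= => h.
  by apply: cV; rewrite -ball_normE /ball_ /=; exact: le_lt_trans er.
apply: (subclosed_compact _ _ sub); first exact: closed_closure.
apply: bounded_closed_compact => //.
exists (e + `|c|); split; first exact: num_real.
move=> M hM y; rewrite closed_ballE// /closed_ball_ /= => h.
rewrite (le_trans _ (ltW hM))// -{1}(subrK c y) (le_trans (ler_normD _ _))//.
by rewrite lerD2r distrC.
Qed.

Lemma ker_nilE (alpha : R) x : ker [::] alpha x = enorm x `^ (- alpha).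
Proof.
rewrite /ker /mon big_nil mul1r enorm_sqn -powR12_sqrt ?sqn_ge0// -powRrM.
by congr (_ `^ _); field.
Qed.

Lemma riesz_mollify (alpha : R) f (rf : rapidly_decreasing f) phi :
  riesz_potential alpha f phi =
   (row_int (fun x => ker [::] alpha x * Re (mollify rf phi x)) +i*
    row_int (fun x => ker [::] alpha x * Im (mollify rf phi x)))%C.
Proof.
rewrite /riesz_potential convolutionE /regular_dist /cintegral.
apply/eqP; rewrite eq_complex /=; apply/andP; split; apply/eqP; apply: eq_Rintegral => t _.
  by rewrite complex_ReM /= mul0r subr0 ker_nilE.
by rewrite complex_ImM /= mul0r addr0 ker_nilE.
Qed.

(** The kernel is real, so the vanishing of the potential separates into its real and imaginary
    parts, and each falls under [decaying_vanishing_eq0]. *)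
Lemma mollify_eq0 (alpha : R) f (rf : rapidly_decreasing f) phi (r : R) :
  (forall m, alpha + 2 * m%:R != 0) -> (forall m, alpha + 2 * m%:R + 2 - d%:R != 0) ->
  0 < r -> (forall x, `|x| < r -> mollify rf phi x = 0) ->
  (forall y, `|y| < r -> riesz_potential alpha f (schwartz_translate y phi) = 0) ->
  forall x, mollify rf phi x = 0.
Proof.
move=> al0 ald r0 F0 R0 x; set F := mollify rf phi.
have [cr ci] := continuous_pderives F [::].
have dec k := schwartz_bound F k [::].
have w0 k (y : E) : 0 <= jbracket y ^+ k by rewrite exprn_ge0 ?jbracket_ge0.
have half y : `|y| < r / 2 -> `|y| < r by move=> h; apply: (lt_trans h); lra.
have core (a : E -> R) : continuous a ->
    (forall k : nat, exists M : R, forall x, jbracket x ^+ k * `|a x| <= M) ->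
    (forall x, `|x| < r -> a x = 0) ->
    (forall y, `|y| < r -> row_int (fun x => ker [::] alpha x * a (x + y)) = 0) ->
    forall z, a z = 0.
  (* The substitution z = x + y turns the integral of |x|^(-alpha) a(x + y) into the moment at
     [y]. *)
  move=> ca da a0 ra; apply: (decaying_vanishing_eq0 ca da r0 a0 al0 ald) => y yr.
  have [_] := row_shift y (row_integrable_ker ca da r0 a0 [::] alpha yr).
  by rewrite /moment => <-; under eq_fun do rewrite addrK; exact: ra (half y yr).
have E0 y : `|y| < r -> (row_int (fun x => ker [::] alpha x * Re (F (x + y))) +i*
    row_int (fun x => ker [::] alpha x * Im (F (x + y))))%C = 0.
  move=> yr; rewrite -[RHS](R0 y yr) (riesz_mollify alpha rf).
  by congr (_ +i* _)%C; apply: eq_Rintegral => t _; rewrite mollify_translate.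
apply/eqP; rewrite eq_complex; apply/andP; split; apply/eqP.
  apply: (core (fun x => Re (F x))) => //.
  - move=> k; have [M hM] := dec k; exists M => y.
    by apply: le_trans (hM y); rewrite ler_wpM2l// normr_Re_le.
  - by move=> y /F0 ->.
  - by move=> y /E0 /eqP; rewrite eq_complex => /andP[/eqP].
apply: (core (fun x => Im (F x))) => //.
- move=> k; have [M hM] := dec k; exists M => y.
  by apply: le_trans (hM y); rewrite ler_wpM2l// normr_Im_le.
- by move=> y /F0 ->.
- by move=> y /E0 /eqP; rewrite eq_complex => /andP[_ /eqP].
Qed.

(** For alpha = d - 1 both numbers are positive, the first because d >= 2; otherwise a zero would
    make alpha an integer. *)
Lemma alpha_nonresonant (alpha : R) : (2 <= d)%N ->
  alpha = d%:R - 1 \/ (alpha \isn't a Num.int /\ alpha < d%:R) ->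
  (forall m, alpha + 2 * m%:R != 0) /\ (forall m, alpha + 2 * m%:R + 2 - d%:R != 0).
Proof.
move=> d2 [->|[ai _]]; split => m.
- have h : 2 <= d%:R :> R by rewrite ler_nat.
  by rewrite gt_eqF//; have := ler0n R m; lra.
- rewrite (_ : _ - _ = 1 + 2 * m%:R); last by ring.
  by rewrite gt_eqF//; have := ler0n R m; lra.
- apply: contra ai => /eqP h; rewrite (_ : alpha = - (2 * m%:R)); last by lra.
  by rewrite rpredN rpredM// rpred_nat.
- apply: contra ai => /eqP h; rewrite (_ : alpha = d%:R - 2 - 2 * m%:R); last by lra.
  by rewrite rpredB ?rpredM ?rpredB ?rpred_nat.
Qed.
End UniqueContinuation.

Theorem theorem5p1 (R : realType) (d : nat) (alpha : R)
    (f : schwartz R d -> R[i]^o) (V : set 'rV[R]_d) :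
  (2 <= d)%N ->
  alpha = d%:R - 1 \/ (alpha \isn't a Num.int /\ alpha < d%:R) ->
  rapidly_decreasing f ->
  open V -> V !=set0 ->
  vanishes_on V f -> vanishes_on V (riesz_potential alpha f) ->
  f = 0.
Proof.
move=> d2 halpha rf oV [v Vv] vf vr.
have [al0 ald] := alpha_nonresonant d2 halpha.
have /nbhs_ballP[r /= r0 rV] : nbhs v V by exact: open_nbhs_nbhs.
(* A bump of radius [e] moved by less than [e] stays within 2e = r/2 < r of [v]. *)
pose e := r / 4; have e0 : 0 < e by rewrite divr_gt0.
apply: (tempered_local_eq0 (proj1 rf) e0) => phi c hphi.
(* [phi] is supported near an arbitrary [c]; this translate is supported near [v], where the
   hypotheses apply. *)
pose psi := schwartz_translate (c - v) phi.
have near_v x y : `|x| < e -> schwartz_translate x psi y != 0 -> `|y - v| <= e + e.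
  move=> xe; rewrite schwartz_translate_add => /hphi h.
  rewrite (_ : y - v = (x + (c - v) + y - c) - x); last first.
    by apply/rowP => i; rewrite !mxE; ring.
  by rewrite (le_trans (ler_normB _ _))// lerD// ltW.
have ee0 : 0 < e + e by rewrite addr_gt0.
have eer : e + e < r by rewrite /e; lra.
have psi0 : forall x, mollify rf psi x = 0.
  apply: (mollify_eq0 al0 ald e0) => x xe.
    rewrite mollifyE; apply: (vanishes_on_ball vf ee0 eer rV).
    by move=> y; exact: near_v.
  apply: (vanishes_on_ball vr ee0 eer rV).
  by move=> y; exact: near_v.
(* The mollification of [psi] vanishes everywhere, not only near 0; its value at [v - c], where the
   translation is undone, is [f phi]. *)
have := psi0 (v - c); rewrite mollifyE schwartz_translate_add => <-.
congr f; apply/val_inj/funext => y; rewrite /= /translate_fun.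
by congr (schwartz_val phi _); apply/rowP => i; rewrite !mxE; ring.
Qed.
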